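(* Let $p$ be a prime, let $G$ be a finite $p$-group and let $F$ be a field of characteristic $p$. Suppose that at least one of the following conditions holds: (i) $\exp G = p$; (ii) $\operatorname{cl}(G) = 2$; (iii) the commutator subgroup $G'$ is cyclic; (iv) $G$ is a group of maximal class and contains an abelian subgroup of index $p$. Then $\operatorname{cl}(G)$ is determined by the group algebra $FG$; that is, for every group $H$ such that $FG \cong FH$ as $F$-algebras, one has $\operatorname{cl}(H) = \operatorname{cl}(G)$.
   Context: For a finite $p$-group $G$: $\operatorname{cl}(G)$ denotes the nilpotency class of $G$, $\exp G$ its exponent, and $G' = [G,G]$ its commutator (derived) subgroup. A finite $p$-group of order $p^n$ is said to be of maximal class if its nilpotency class equals $n-1$ (with $n \geq 2$). $FG$ denotes the group algebra of $G$ over $F$. A property or invariant of $G$ is ''determined by the group algebra $FG$'' if every group $H$ with $FG \cong FH$ as $F$-algebras has the same property or value of the invariant. *)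

(* Defs.v *)
From HB Require Import structures.
From mathcomp Require Import all_boot all_order all_fingroup all_algebra.
From mathcomp Require Import all_solvable finmap.
From mathcomp.multinomials Require Import monalg.

Set Implicit Arguments.
Unset Strict Implicit.
Unset Printing Implicit Defensive.

Import GroupScope GRing.Theory.
Local Open Scope fset_scope.
Local Open Scope ring_scope.

(* The ring structure that monalg puts on {malg R[K]} requires K to be a
   monomType, i.e. a monoid in which x * y = 1 forces x = y = 1; no nontrivial
   group is one. Only the F-module of finitely supported functions is reused. *)
Definition group_algebra (F : fieldType) (G : groupType) : Type := {malg F[G]}.

Section GroupAlgebra.
Variables (F : fieldType) (G : groupType).
Implicit Types (u v w : {malg F[G]}) (x y : G).

HB.instance Definition _ := GRing.Lmodule.on (group_algebra F G).

Definition galg_one : {malg F[G]} := << 1%g >>.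

Definition galg_mul u v : {malg F[G]} :=
  \sum_(x <- msupp u) \sum_(y <- msupp v) << u@_x * v@_y *g (x * y)%g >>.

Lemma galg_mulr u v : galg_mul u v =
  \sum_(y <- msupp v) \sum_(x <- msupp u) << u@_x * v@_y *g (x * y)%g >>.
Proof. by rewrite /galg_mul exchange_big. Qed.

Lemma galg_mullw (d1 d2 : {fset G}) u v :
  msupp u `<=` d1 -> msupp v `<=` d2 ->
  galg_mul u v = \sum_(x <- d1) \sum_(y <- d2) << u@_x * v@_y *g (x * y)%g >>.
Proof.
move=> le_d1 le_d2; rewrite /galg_mul (big_fset_incl _ le_d1) /=.
  apply/eq_bigr=> x _; apply/big_fset_incl => // y _ /mcoeff_outdom ->.
  by rewrite mulr0 monalgU0.
move=> x _ /mcoeff_outdom ux.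
by rewrite big1 => // y _; rewrite ux mul0r monalgU0.
Qed.

Lemma galg_mulrw (d1 d2 : {fset G}) u v :
  msupp u `<=` d1 -> msupp v `<=` d2 ->
  galg_mul u v = \sum_(y <- d2) \sum_(x <- d1) << u@_x * v@_y *g (x * y)%g >>.
Proof. by move=> le1 le2; rewrite (galg_mullw le1 le2) exchange_big. Qed.

Lemma galg_mul0 : left_zero 0 galg_mul.
Proof. by move=> u; rewrite /galg_mul msupp0 big_seq_fset0. Qed.

Lemma galg_mulx0 : right_zero 0 galg_mul.
Proof. by move=> u; rewrite galg_mulr msupp0 big_seq_fset0. Qed.

Lemma galg_mulUg c x u :
  galg_mul << c *g x >> u = \sum_(y <- msupp u) << c * u@_y *g (x * y)%g >>.
Proof.
rewrite (galg_mullw msuppU_le (fsubset_refl _)) big_seq_fset1.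
by apply/eq_bigr => y _; rewrite mcoeffUU.
Qed.

Lemma galg_mulgU c x u :
  galg_mul u << c *g x >> = \sum_(y <- msupp u) << u@_y * c *g (y * x)%g >>.
Proof.
rewrite (galg_mulrw (fsubset_refl _) msuppU_le) big_seq_fset1.
by apply/eq_bigr=> y _; rewrite mcoeffUU.
Qed.

Lemma galg_mulUU c d x y :
  galg_mul << c *g x >> << d *g y >> = << c * d *g (x * y)%g >>.
Proof.
by rewrite (galg_mulrw msuppU_le msuppU_le) !big_seq_fset1 !mcoeffUU.
Qed.

Lemma galg_mulEl u v :
  galg_mul u v = \sum_(x <- msupp u) galg_mul << u@_x *g x >> v.
Proof. by apply/eq_bigr=> x _; rewrite galg_mulUg. Qed.

Lemma galg_mulEr u v :
  galg_mul u v = \sum_(y <- msupp v) galg_mul u << v@_y *g y >>.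
Proof. by rewrite galg_mulr; apply/eq_bigr=> y _; rewrite galg_mulgU. Qed.

Lemma galg_mul1 : left_id galg_one galg_mul.
Proof.
move=> u; rewrite galg_mulUg [RHS]monalgE.
by apply/eq_bigr=> x _; rewrite mul1r mul1g.
Qed.

Lemma galg_mulx1 : right_id galg_one galg_mul.
Proof.
move=> u; rewrite galg_mulgU [RHS]monalgE.
by apply/eq_bigr=> x _; rewrite mulr1 mulg1.
Qed.

Lemma galg_mulDl : left_distributive galg_mul +%R.
Proof.
move=> u v w.
rewrite [in RHS](galg_mullw (fsubsetUl _ (msupp v)) (fsubset_refl _)).
rewrite [X in _ = _ + X](galg_mullw (fsubsetUr (msupp u) _) (fsubset_refl _)).
rewrite (galg_mullw (msuppD_le _ _) (fsubset_refl _)).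
rewrite -big_split /=; apply/eq_bigr=> x _.
rewrite -big_split /=; apply/eq_bigr=> y _.
by rewrite mcoeffD mulrDl monalgUD.
Qed.

Lemma galg_mulDr : right_distributive galg_mul +%R.
Proof.
move=> w u v.
rewrite [in RHS](galg_mulrw (fsubset_refl _) (fsubsetUl _ (msupp v))).
rewrite [X in _ = _ + X](galg_mulrw (fsubset_refl _) (fsubsetUr (msupp u) _)).
rewrite (galg_mulrw (fsubset_refl _) (msuppD_le _ _)).
rewrite -big_split /=; apply/eq_bigr => x _.
rewrite -big_split /=; apply/eq_bigr => y _.
by rewrite mcoeffD mulrDr monalgUD.
Qed.

Lemma galg_mulA : associative galg_mul.
Proof.
move=> u v w.
rewrite [RHS](big_morph (galg_mul^~ _) (fun _ _ => galg_mulDl _ _ _)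
  (galg_mul0 _)).
rewrite galg_mulEl; apply/eq_bigr=> x _.
rewrite [LHS](big_morph (galg_mul _) (fun _ _ => galg_mulDr _ _ _)
  (galg_mulx0 _)).
rewrite [RHS](big_morph (galg_mul^~ _) (fun _ _ => galg_mulDl _ _ _)
  (galg_mul0 _)).
apply/eq_bigr=> y _.
rewrite [LHS](big_morph (galg_mul _) (fun _ _ => galg_mulDr _ _ _)
  (galg_mulx0 _)).
by rewrite galg_mulEr; apply/eq_bigr=> z _; rewrite !galg_mulUU mulrA mulgA.
Qed.

Lemma galg_one_neq0 : galg_one != 0.
Proof. by apply/eqP/malgP=> /(_ 1%g) /eqP; rewrite !mcoeffsE oner_eq0. Qed.

HB.instance Definition _ := GRing.Zmodule_isNzRing.Build (group_algebra F G)
  galg_mulA galg_mul1 galg_mulx1 galg_mulDl galg_mulDr galg_one_neq0.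

Lemma galg_mulZ c u : c *: u = galg_mul << c *g 1%g >> u.
Proof.
rewrite galg_mulUg malgZ_def; apply: eq_bigr => x _.
by rewrite mul1g.
Qed.

Lemma galg_scaleAl (c : F) (u v : group_algebra F G) :
  c *: (u * v) = (c *: u) * v.
Proof.
transitivity (galg_mul << c *g 1%g >> (galg_mul u v)); first exact: galg_mulZ.
by rewrite galg_mulA -galg_mulZ.
Qed.

HB.instance Definition _ :=
  GRing.Lmodule_isLalgebra.Build F (group_algebra F G) galg_scaleAl.

Lemma galg_scaleAr (c : F) (u v : group_algebra F G) :
  c *: (u * v) = u * (c *: v).
Proof.
rewrite -[LHS]/(c *: galg_mul u v : {malg F[G]}).
rewrite -[RHS]/(galg_mul u (c *: (v : {malg F[G]}))).
rewrite !galg_mulZ !galg_mulA; congr galg_mul.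
rewrite galg_mulUg galg_mulgU; apply: eq_bigr => x _.
by rewrite mul1g mulg1 mulrC.
Qed.

HB.instance Definition _ :=
  GRing.Lalgebra_isAlgebra.Build F (group_algebra F G) galg_scaleAr.

End GroupAlgebra.

Definition galg_isomorphic (F : fieldType) (G H : groupType) : Prop :=
  exists f : {lrmorphism group_algebra F G -> group_algebra F H}, bijective f.

(* The lower central series and the class of MathComp are restricted to finite
   groups; the following ones make sense for every group. *)
Inductive generated (G : groupType) (X : G -> Prop) : G -> Prop :=
| generated_mem x of X x : generated X x
| generated_1 : generated X 1%g
| generated_M x y of generated X x & generated X y : generated X (x * y)%g
| generated_V x of generated X x : generated X x^-1%g.

(* Indexed from 0: lower_central G n is gamma_(n+1)(G). *)
Fixpoint lower_central (G : groupType) (n : nat) : G -> Prop :=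
  if n is m.+1 then
    generated (fun z => exists x y : G, lower_central m x /\ z = [~ x, y]%g)
  else fun=> True.

Definition trivial_term (G : groupType) (n : nat) : Prop :=
  forall x : G, lower_central n x -> x = 1%g.

Definition nilpotent_of_class (G : groupType) (c : nat) : Prop :=
  trivial_term G c /\ forall m, trivial_term G m -> (c <= m)%N.

Lemma lower_centralP (gT : finGroupType) n (x : gT) :
  lower_central n x <-> x \in 'L_n.+1([set: gT])%g.
Proof.
elim: n x => [|n IHn] x; first by rewrite lcn1 inE.
rewrite lcnSn; split=> /=.
  elim=> {x}.
  - move=> _ [x [y [/IHn Lx ->]]]; by rewrite mem_commg ?inE.
  - exact: group1.
  - by move=> x y _ Lx _ Ly; rewrite groupM.
  - by move=> x _ Lx; rewrite groupV.
case/gen_prodgP=> m [c Lc ->]; elim/big_ind: _ => [|y z|i _].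
- exact: generated_1.
- exact: generated_M.
apply: generated_mem; case/imset2P: (Lc i) => y z Ly _ ->.
by exists y, z; split=> //; apply/IHn.
Qed.

Lemma nilpotent_of_classP (gT : finGroupType) c :
  nilpotent_of_class gT c <->
  nilpotent [set: gT] /\ nil_class [set: gT] = c.
Proof.
have trivP n : trivial_term gT n <-> 'L_n.+1([set: gT])%g = 1%g.
  split=> [triv | L1 x /lower_centralP].
    by apply/trivgP/subsetP=> x /lower_centralP/triv->; rewrite inE.
  by rewrite L1 => /set1P.
split=> [[/trivP Lc min] | [nilG <-]].
  have nilG : nilpotent [set: gT] by apply/lcnP; exists c.
  split=> //; apply/eqP; rewrite eqn_leq; apply/andP; split.
    exact/(lcn_nil_classP c nilG).
  by apply: min; apply/trivP/(lcn_nil_classP _ nilG).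
split; first by apply/trivP/(lcn_nil_classP _ nilG).
by move=> m /trivP Lm; apply/(lcn_nil_classP m nilG).
Qed.

Definition maximal_class (p : nat) (gT : finGroupType) (G : {set gT}) : Prop :=
  exists n : nat, [/\ (2 <= n)%N, #|G| = (p ^ n)%N & nil_class G = n.-1].

(* Main.v *)
From HB Require Import structures.
Require Import Defs.
From mathcomp Require Import all_boot all_order all_fingroup all_algebra.
From mathcomp Require Import all_solvable falgebra algC.
From mathcomp Require Import classfun character integral_char finmap zify.
From mathcomp.multinomials Require Import monalg.

(** Call group basis of an F-algebra A a basis of A whose elements multiply like
    a group.  An isomorphism between FG and FH provides one algebra A with two
    group bases, indexed by G and by H.  (That H is finite follows: every h in H
    lies in the support of the image of some element of G.)  It remains to read
    off from A alone what determines the class.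

    Numerical invariants.  Let r : G -> G choose a representative in each part
    of a partition of G.  The linear map of A sending x to r x (collapse) has as
    kernel the common zeros of the linear forms constant on the parts.  For the
    conjugacy classes these are the forms with phi (uv) = phi (vu), for the
    cosets of G' those with phi (uvw) = phi (vuw): no reference to G is left.
    Dimensions of images then show that |G|, the number of classes and |G : G'|
    depend on A only.  As G is a p-group and F has characteristic p, the image
    of the centre of A is spanned by the image of Z(G), every other class
    contributing a multiple of p; this gives |Z(G)| and |Z(G) : Z(G) :&: G'|, so
    also |Z(G) :&: G'|.  Class 2 means that G' is nontrivial and of the same
    order as Z(G) :&: G', which settles that case.

    Cyclic G'.  The kernel of the projection of A onto F[G/G'] is principal as a
    left ideal if and only if G' is cyclic, because A is a local ring
    (aug_unit).  If N is a cyclic normal subgroup of G, then [N, G] and C_N(G)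
    have orders with product |N|; so |G'| and |Z(G) :&: G'| determine the order
    of every term of the lower central series.

    Maximal class with an abelian subgroup of index p.  Complex irreducible
    characters of G have degree 1 or p.  The sum of their squared degrees is the
    group order, there are |G : G'| linear ones and as many in all as classes;
    so equal invariants force the same degrees on H.  As Z(H) has order p, H has
    a faithful irreducible character, and it yields an abelian subgroup of
    index p of H; commutation with an element outside it has a kernel of order
    at most p on each lower central term, so that H has maximal class.

    Exponent p.  If phi (uv) = phi (vu), then phi (u ^ p) is the sum of the
    phi (x ^ p) weighted by the p-th powers of the coefficients of u; so A
    detects exponent p.  Let D be the augmentation ideal.  The space
    lcn_layer k, spanned by D ^ (k + 2) and the x - 1 with x in the (k + 1)-st
    lower central term, arises from D by taking Lie commutators with D, and
    therefore is the same for G and H.  In exponent p, x - 1 lies in D ^ n only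
    if x lies in the n-th lower central term (lcn_of_aug_power, an instance of
    the theorem of Jennings on dimension subgroups).  If the (k + 1)-st term of
    G is trivial, the layer is D ^ (k + 2), so the (k + 1)-st term of H is
    contained in the next one and is trivial too. *)

Set Implicit Arguments.
Unset Strict Implicit.
Unset Printing Implicit Defensive.

Import Order.TTheory GroupScope GRing.Theory Num.Theory.

(** * Lower central series *)

(** Induction on i with the three subgroup lemma, applied modulo the target. *)
Lemma lcn_comm (gT : finGroupType) (G : {group gT}) i j :
  [~: 'L_i(G), 'L_j(G)]%g \subset 'L_(i + j)(G)%g.
Proof.
case: i => [|i]; first by rewrite commg_subr; apply: lcn_norm.
case: j => [|j]; first by rewrite addn0 commg_subl; apply: lcn_norm.
elim: i j => [|i IHi] j; first by rewrite lcn1 commGC lcnSnS.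
pose N := [group of 'L_(i.+2 + j.+1)(G)%g].
have nN k : 'L_k(G) \subset 'N(N).
  by apply: subset_trans (lcn_sub _ _) (lcn_norm _ _).
have nG : G \subset 'N(N) by apply: lcn_norm.
have nR (X Y : {group gT}) :
    X \subset 'N(N) -> Y \subset 'N(N) -> [~: X, Y] \subset 'N(N).
  by move=> nX nY; rewrite comm_subG.
rewrite lcnSn; suff: [~: 'L_i.+1(G), G, 'L_j.+1(G)]%g \subset N by [].
rewrite -quotient_sub1; last by rewrite !nR ?nN.
rewrite !quotientR ?nR ?nN //.
have s1 : [~: G, 'L_j.+1(G), 'L_i.+1(G)]%g \subset N.
  rewrite (commGC G) -lcnSn commGC; apply: subset_trans (IHi _) _.
  by have -> : (i.+1 + j.+2 = i.+2 + j.+1)%N by lia.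
have s2 : [~: 'L_j.+1(G), 'L_i.+1(G), G]%g \subset N.
  rewrite (commGC 'L_j.+1(G)%g); apply: subset_trans (commSg _ (IHi _)) _.
  exact: lcnSnS.
apply/trivgP.
apply/(@three_subgroup _ (G / N)%G ('L_j.+1(G) / N)%G ('L_i.+1(G) / N)%G) => /=.
  by rewrite -!quotientR ?nR ?nN // quotientS1.
by rewrite -!quotientR ?nR ?nN // quotientS1.
Qed.

(** A term of the series is generated by commutators, so a property stable
    under products need only be checked on these. *)
Lemma lcnS_ind (gT : finGroupType) (G : {group gT}) k (P : gT -> Prop) :
  P 1%g -> (forall x y, x \in 'L_k.+2(G)%g -> P x -> P y -> P (x * y)%g) ->
  (forall x y, x \in 'L_k.+1(G)%g -> P [~ x, y]%g) ->
  forall x, x \in 'L_k.+2(G)%g -> P x.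
Proof.
move=> P1 PM PR x; rewrite lcnSn => /gen_prodgP[n [d dR ->]].
elim: n d dR => [|n IHn] d dR; first by rewrite big_ord0.
rewrite big_ord_recl; apply: PM; last by apply: IHn => i; apply: dR.
  by rewrite lcnSn mem_gen ?dR.
by have /imset2P[y z Ly _ ->] := dR ord0; apply: PR.
Qed.

Lemma nil_class_eq (gT hT : finGroupType) (G : {group gT}) (H : {group hT}) :
  nilpotent G -> nilpotent H ->
  (forall n, ('L_n.+1(G) == 1) = ('L_n.+1(H) == 1)) ->
  nil_class H = nil_class G.
Proof.
move=> nilG nilH eqL; apply/eqP; rewrite eqn_leq.
apply/andP; split.
  apply/(lcn_nil_classP _ nilH)/eqP; rewrite -eqL.
  exact/eqP/(lcn_nil_classP _ nilG).
apply/(lcn_nil_classP _ nilG)/eqP; rewrite eqL.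
exact/eqP/(lcn_nil_classP _ nilH).
Qed.

Lemma nil_class2P (gT : finGroupType) (G : {group gT}) : nilpotent G ->
  reflect (G^`(1) != 1 /\ G^`(1) \subset 'Z(G)) (nil_class G == 2).
Proof.
move=> nilG; rewrite eqn_leq ltnNge (sameP (lcn_nil_classP 2 nilG) commG1P).
rewrite (sameP (lcn_nil_classP 1 nilG) eqP) lcn2 subsetI der_sub.
by rewrite /= andbC; apply: andP.
Qed.

(** * Cyclic normal subgroups *)

(** Let z generate N.  The subgroups of N form a chain, so among the commutators
    of z with G there is one, c = [z, g], that generates all of them.  The map
    z ^ i |-> c ^ i = [z ^ i, g] then has image [N, G] and kernel C_N(G). *)
Lemma card_comm_cent_cyclic (gT : finGroupType) (p : nat) (G N : {group gT}) :
  prime p -> p.-group G -> cyclic N -> N <| G ->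
  (#|[~: N, G]| * #|'C_N(G)| = #|N|)%N.
Proof.
move=> p_pr pG cycN nNG; have [sNG nNG'] := andP nNG.
have pN := pgroupS sNG pG.
have /cyclicP[z defN] := cycN.
have Nz : z \in N by rewrite defN cycle_id.
have NR g : g \in G -> [~ z, g] \in N.
  by move=> Gg; rewrite groupMl ?groupV // memJ_norm // (subsetP nNG').
have RX g i : g \in G -> [~ z ^+ i, g] = [~ z, g] ^+ i.
  move=> Gg; have cz : commute z^-1 (z ^ g).
    apply: (centsP (cyclic_abelian cycN)); rewrite ?groupV //.
    by rewrite memJ_norm // (subsetP nNG').
  by rewrite !commgEl (expgMn _ cz) expgVn -conjXg.
have [g Gg maxg] : exists2 g, g \in G &
    forall h, h \in G -> (#[[~ z, h]] <= #[[~ z, g]])%N.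
  case: (arg_maxnP (P := [in G]) (fun h => #[[~ z, h]]) (group1 G)) => g Gg mg.
  by exists g.
set c := [~ z, g] in maxg.
have Rc h : h \in G -> [~ z, h] \in <[c]>.
  move=> Gh; rewrite -cycle_subG -(cardSg_cyclic cycN) ?cycle_subG ?NR //.
  have /p_natP[i ei] := mem_p_elt pN (NR _ Gh).
  have /p_natP[j ej] := mem_p_elt pN (NR _ Gg).
  move: (maxg h Gh); rewrite -!orderE /c ei ej.
  by rewrite leq_exp2l ?prime_gt1 // => /dvdn_exp2l->.
have defR : [~: N, G] = <[c]>.
  apply/eqP; rewrite eqEsubset; apply/andP; split.
    rewrite gen_subG; apply/subsetP=> _ /imset2P[x h Nx Gh ->].
    move: Nx; rewrite defN => /cycleP[i ->].
    by rewrite RX // groupX ?Rc.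
  by rewrite cycle_subG mem_commg.
have defC : 'C_N(G) = <[z ^+ #[c]]>.
  apply/setP=> x; rewrite inE; apply/andP/idP => [[]|].
    rewrite defN => /cycleP[i ->] /centP/(_ _ Gg)/commgP.
    rewrite RX // -order_dvdn => /dvdnP[k ->].
    by rewrite mulnC expgM mem_cycle.
  case/cycleP=> i ->; rewrite -expgM; split; first by rewrite groupX.
  apply/centP=> h Gh; apply/commgP; rewrite RX // -order_dvdn dvdn_mulr //.
  by rewrite order_dvdG ?Rc.
have oz : #|N| = #[z] by rewrite defN.
have dvd_c : #[c] %| #[z] by rewrite -oz order_dvdG ?NR.
by rewrite defR defC -!orderE orderXdiv // oz mulnC divnK.
Qed.

(** The subgroups of the cyclic group K' form a chain, so the centraliser of K
    in a lower central term inside K' is the smaller of this term and C_{K'}(K);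
    thus card_comm_cent_cyclic is a recursion for the orders. *)
Lemma card_lcn_der1_cyclic (gT hT : finGroupType) (p : nat)
    (G : {group gT}) (H : {group hT}) :
    prime p -> p.-group G -> p.-group H -> cyclic G^`(1) -> cyclic H^`(1) ->
    #|G^`(1)| = #|H^`(1)| -> #|'C_(G^`(1))(G)| = #|'C_(H^`(1))(H)| ->
  forall n, #|'L_n.+2(G)| = #|'L_n.+2(H)|.
Proof.
move=> p_pr pG pH cG cH eqD eqC.
have step n (kT : finGroupType) (K : {group kT}) : p.-group K ->
    cyclic K^`(1) ->
    (#|'L_n.+3(K)| * minn #|'L_n.+2(K)| #|'C_(K^`(1))(K)| = #|'L_n.+2(K)|)%N.
  move=> pK cK.
  have sLD : 'L_n.+2(K) \subset K^`(1) by rewrite -lcn2 lcn_sub_leq.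
  have cL := cyclicS sLD cK.
  have nL : 'L_n.+2(K) <| K := lcn_normal _ _.
  rewrite lcnSn -[RHS](card_comm_cent_cyclic p_pr pK cL nL); congr (_ * _)%N.
  have pD : p.-group K^`(1) := pgroupS (der_sub 1 K) pK.
  have -> : 'C_('L_n.+2(K))(K) = 'L_n.+2(K) :&: 'C_(K^`(1))(K).
    by rewrite setIA (setIidPl sLD).
  have sCD : 'C_(K^`(1))(K) \subset K^`(1) := subsetIl _ _.
  have /p_natP[i ei] := pgroupS sLD pD.
  have /p_natP[j ej] := pgroupS sCD pD.
  rewrite ei ej; case: (leqP i j) => [leij | /ltnW leji].
    rewrite (minn_idPl _) ?leq_exp2l ?prime_gt1 //.
    rewrite (setIidPl _) ?ei // -(cardSg_cyclic cK) // ei ej.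
    by rewrite dvdn_exp2l.
  rewrite (minn_idPr _) ?leq_exp2l ?prime_gt1 //.
  rewrite (setIidPr _) ?ej // -(cardSg_cyclic cK) // ei ej.
  by rewrite dvdn_exp2l.
elim=> [|n IHn]; first by rewrite !lcn2.
have eH := step n _ _ pH cH; rewrite -IHn -eqC in eH.
have m_gt0 : (0 < minn #|'L_n.+2(G)| #|'C_(G^`(1))(G)|)%N.
  by rewrite leq_min !cardG_gt0.
by apply/eqP; rewrite -(eqn_pmul2r m_gt0) eH (step n).
Qed.

(** * Groups of maximal class *)

(** The n - 1 steps of the lower central series, the first of index at least
    p ^ 2, leave no freedom in a group of order p ^ n.  If the centre had order
    above p, then G / Z(G) would have class n - 2 and order at most p ^ (n - 2);
    so it would be cyclic and G abelian. *)
Lemma maximal_class_indices (gT : finGroupType) (p n : nat) (G : {group gT}) :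
  prime p -> #|G| = (p ^ n)%N -> nil_class G = n.-1 -> ~~ abelian G ->
  [/\ (3 <= n)%N, #|G : G^`(1)| = (p ^ 2)%N & #|'Z(G)| = p].
Proof.
move=> p_pr oG clG nabG.
have pG : p.-group G by rewrite /pgroup oG pnatX pnat_id // orbT.
have nilG := pgroup_nil pG.
have n_gt2 : (2 < n)%N.
  have : ~~ (nil_class G <= 1)%N.
    apply: contra nabG => /(lcn_nil_classP 1 nilG) D1.
    by rewrite abelianE; apply/commG1P.
  by rewrite clG; lia.
have p_gt1 := prime_gt1 p_pr; have p_gt0 := prime_gt0 p_pr.
(* counted from the last nontrivial term, which has index n - 1 *)
have L_ge k : (k <= n - 2 -> p ^ k.+1 <= #|'L_(n.-1 - k)(G)|)%N.
  elim: k => [_ | k IHk ltk].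
    rewrite subn0 expn1.
    have : 'L_n.-1(G) != 1.
      apply/eqP=> L1; have : (nil_class G <= n.-2)%N.
        by apply/(lcn_nil_classP _ nilG); rewrite prednK //; lia.
      by rewrite clG; lia.
    have pL : p.-group 'L_n.-1(G) := pgroupS (lcn_sub _ _) pG.
    have /p_natP[[|j] ej] := pL; first by rewrite -cardG_gt1 ej.
    by move=> _; rewrite ej -{1}(expn1 p) leq_exp2l.
  have /IHk {}IHk : (k <= n - 2)%N by rewrite ltnW.
  set m := (n.-1 - k.+1)%N.
  have m_gt0 : (0 < m)%N by rewrite /m; lia.
  have em : (n.-1 - k = m.+1)%N by rewrite /m; lia.
  rewrite em in IHk.
  have ntL : 'L_m(G) != 1.
    apply: contraTneq IHk => L1.
    have -> : 'L_m.+1(G) = 1 by apply/trivgP; rewrite -L1 lcn_sub_leq.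
    by rewrite cards1 -ltnNge -{1}(exp1n k.+1) ltn_exp2r.
  have prL : 'L_m.+1(G) \proper 'L_m(G).
    rewrite -(prednK m_gt0) in ntL *; rewrite lcnSn.
    by rewrite (nil_comm_properl nilG) ?lcn_sub // subsetI subxx lcn_norm.
  have /p_natP[j ej] := pgroupS (lcn_sub m G) pG.
  have /p_natP[i ei] := pgroupS (lcn_sub m.+1 G) pG.
  have := proper_card prL; move: IHk; rewrite ej ei ltn_exp2l // !leq_exp2l //.
  by move=> ltki ltij; apply: leq_ltn_trans ltij.
have sD := der_sub 1 G.
have D_ge : (p ^ (n - 2) <= #|G^`(1)|)%N.
  have := L_ge (n - 3)%N; rewrite -lcn2.
  have -> : (n.-1 - (n - 3) = 2)%N by lia.
  have -> : (n - 3).+1 = (n - 2)%N by lia.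
  by apply; lia.
have ncQ : ~~ cyclic (G / G^`(1)).
  apply: contra nabG => /(cyclic_nilpotent_quo_der1_cyclic nilG).
  exact: cyclic_abelian.
split=> //.
  have /p_natP[j ej] : p.-nat #|G : G^`(1)|.
    by apply: pnat_dvd pG; rewrite -(Lagrange sD) dvdn_mull.
  have: (#|G : G^`(1)| <= p ^ 2)%N.
    rewrite -(leq_pmul2l (cardG_gt0 G^`(1))) Lagrange // oG.
    by rewrite -{1}(subnK (ltnW n_gt2)) expnD leq_pmul2r ?expn_gt0 ?p_gt0.
  rewrite ej leq_exp2l // => le_j2; congr (_ ^ _)%N; apply/eqP.
  rewrite eqn_leq le_j2 ltnNge; apply: contra ncQ => le_j1.
  have := card_quotient (der_norm 1 G); rewrite ej.
  case: j le_j1 {ej le_j2} => [|[|//]] _ oQ.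
    by rewrite (card1_trivg oQ) cyclic1.
  by rewrite prime_cyclic // oQ expn1.
have sZ := center_sub G.
have /p_natP[j ej] := pgroupS sZ pG.
have j_gt0 : (0 < j)%N.
  case: j ej => // /card1_trivg/(trivg_center_pgroup pG) G1.
  by rewrite G1 abelian1 in nabG.
have oQ : #|G / 'Z(G)| = (p ^ (n - j))%N.
  apply/eqP; rewrite -(eqn_pmul2r (cardG_gt0 'Z(G))).
  rewrite card_quotient ?normal_norm ?center_normal // mulnC Lagrange // oG ej.
  rewrite -expnD subnK // -(leq_exp2l _ _ p_gt1) -ej -oG.
  exact: subset_leq_card.
have := nil_class_pgroup (quotient_pgroup 'Z(G) pG).
rewrite nil_class_quotient_center // clG oQ pfactorK //.
rewrite ej; case: j j_gt0 {ej} oQ => [|[|j]] // _ oQ.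
have ncZ : ~~ cyclic (G / 'Z(G)).
  by apply: contra nabG => cQ; apply: cyclic_center_factor_abelian.
rewrite leq_max; case/orP => [le_n3 | ].
  case/negP: ncZ; have ->: G / 'Z(G) = (G / 'Z(G))%G by [].
  have n3: n = 3 by lia.
  rewrite n3 in oQ; case: j oQ => [|j] oQ.
    by rewrite prime_cyclic // oQ expn1.
  by rewrite (card1_trivg oQ) cyclic1.
by lia.
Qed.

(** For t outside M, an element of M that commutes with t is central, so the
    centraliser of t in a lower central term L has order at most p.  The
    conjugates of t under L lie in t [L, H]; hence each term has index at most p
    in the preceding one, and the series reaches length n - 1. *)
Lemma nil_class_of_abelian_index_p (gT : finGroupType) (p n : nat)
    (H M : {group gT}) :
    prime p -> #|H| = (p ^ n)%N -> (3 <= n)%N ->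
    M \subset H -> abelian M -> #|H : M| = p ->
    #|'Z(H)| = p -> #|H : H^`(1)| = (p ^ 2)%N ->
  nil_class H = n.-1.
Proof.
move=> p_pr oH n_gt2 sMH abM oM oZ oD.
have pH : p.-group H by rewrite /pgroup oH pnatX pnat_id // orbT.
have nilH := pgroup_nil pH.
have p_gt0 := prime_gt0 p_pr.
have maxM : maximal M H by apply: p_index_maximal; rewrite ?oM.
have nMH : M <| H := p_maximal_normal pH maxM.
have /properP[_ [t Ht nMt]] := maxgroupp maxM.
have sDM : H^`(1) \subset M.
  rewrite der1_min ?normal_norm // cyclic_abelian // prime_cyclic //.
  by rewrite card_quotient ?normal_norm // oM.
have sCZ : 'C_M[t] \subset 'Z(H).
  apply/subsetP=> k /setIP[Mk Ck]; rewrite inE (subsetP sMH) //=.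
  rewrite -sub_cent1.
  have nprop : ~~ ('C_H[k]%G \proper H).
    apply: contraNN nMt => prC; have [_ maxC] := maxgroupP maxM.
    rewrite -(maxC 'C_H[k]%G prC); first by rewrite inE Ht cent1C.
    rewrite subsetI sMH sub_cent1; apply/centP=> y My.
    exact: (centsP abM).
  by move: nprop; rewrite properE subsetIl negbK subsetI subxx sub_cent1.
have L_ge k : (k <= n - 2 -> p ^ (n - 2 - k) <= #|'L_k.+2(H)|)%N.
  elim: k => [_ | k IHk ltk].
    rewrite subn0 lcn2 -(@leq_pmul2r (p ^ 2)) ?expn_gt0 ?p_gt0 //.
    by rewrite -expnD subnK ?(ltnW n_gt2) // -oH -oD Lagrange ?der_sub.
  have sLM : 'L_k.+2(H) \subset M.
    by apply: subset_trans sDM; rewrite -lcn2 lcn_sub_leq.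
  have le_t : (#|'L_k.+2(H) : 'C_('L_k.+2(H))[t]| <= #|'L_k.+3(H)|)%N.
    rewrite index_cent1 -(card_lcoset _ t); apply: subset_leq_card.
    apply/subsetP=> _ /imsetP[h Lh ->]; rewrite mem_lcoset -/(commg t h).
    by rewrite -invg_comm groupV /= lcnSn mem_commg.
  have oC : (#|'C_('L_k.+2(H))[t]| <= p)%N.
    rewrite -oZ subset_leq_card // (subset_trans _ sCZ) //.
    by rewrite setSI.
  have := IHk (ltnW ltk).
  have -> : (n - 2 - k = (n - 2 - k.+1).+1)%N by clear -ltk; lia.
  rewrite -(Lagrange (subsetIl 'L_k.+2(H) 'C[t])) expnS => leL.
  rewrite -(leq_pmul2l p_gt0); apply: leq_trans leL _.
  by apply: leq_mul.
apply/eqP; rewrite eqn_leq; apply/andP; split.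
  have := nil_class_pgroup pH; rewrite oH pfactorK //.
  by move/leq_trans; apply; clear -n_gt2; lia.
rewrite leqNgt; apply/negP=> lt_cl.
have /(lcn_nil_classP _ nilH) L1 : (nil_class H <= n.-2)%N.
  by clear -lt_cl; lia.
have := L_ge (n - 3)%N.
have -> : ((n - 3).+2 = n.-2.+1)%N by clear -n_gt2; lia.
have -> : (n - 2 - (n - 3) = 1)%N by clear -n_gt2; lia.
rewrite L1 cards1 expn1 => le_p1; have := prime_gt1 p_pr.
by rewrite ltnNge le_p1 // leq_sub2l.
Qed.

(** * Irreducible characters of degree at most p *)

Local Open Scope ring_scope.

Lemma irr1_le_abelian_index (gT : finGroupType) (G A : {group gT}) i :
  abelian A -> A \subset G -> ('chi[G]_i 1%g <= #|G : A|%:R)%R.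
Proof.
move=> abA sAG.
have /neq0_has_constt[j Aj] : 'Res[A] 'chi_i != 0%R by rewrite Res_irr_neq0.
have linj : 'chi_j \is a linear_char by apply/char_abelianP.
have Gi : i \in irr_constt ('Ind[G] 'chi_j) by rewrite constt_Ind_Res.
have := char1_ge_constt (cfInd_char _ (irr_char j)) Gi.
by rewrite cfInd1 // (lin_char1 linj) mulr1.
Qed.

Lemma irr1_pgroup_ge (gT : finGroupType) p (G : {group gT}) i :
  prime p -> p.-group G -> 'chi[G]_i \isn't a linear_char ->
  (p%:R <= 'chi_i 1%g)%R.
Proof.
move=> p_pr pG; rewrite qualifE /= irr_char /=.
have [d d1] : exists d : nat, 'chi_i 1%g = d%:R.
  by apply/natrP; exact: Cnat_irr1.
have := dvd_irr1_cardG i; rewrite d1 dvdC_nat => dvd_d.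
have /p_natP[[|j] ->] : p.-nat d by apply: pnat_dvd pG.
  by rewrite expn0 eqxx.
by move=> _; rewrite ler_nat -{1}(expn1 p) leq_exp2l ?prime_gt1.
Qed.

(** For G, all nonlinear characters have degree exactly p.  The three numbers
    give the number of nonlinear characters of H and the sum of their squared
    degrees, whose average is thus p ^ 2; as each degree is at least p, all are
    equal to p. *)
Lemma irr1_le_invariant (gT hT : finGroupType) (p : nat)
    (G : {group gT}) (H : {group hT}) :
    prime p -> p.-group G -> p.-group H ->
    #|G| = #|H| -> #|classes G| = #|classes H| ->
    #|G : G^`(1)%g| = #|H : H^`(1)%g| ->
    (forall i, 'chi[G]_i 1%g <= p%:R)%R ->
  (forall i, 'chi[H]_i 1%g <= p%:R)%R.
Proof.
move=> p_pr pG pH eqo eqk eqD leG.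
have p2 : (p ^ 2)%N%:R = p%:R ^+ 2 :> algC by rewrite natrX.
have sumE (kT : finGroupType) (K : {group kT}) :
  #|K|%:R = #|K : K^`(1)%g|%:R +
    \sum_(i | 'chi[K]_i \isn't a linear_char) 'chi_i 1%g ^+ 2 :> algC.
  rewrite -(irr_sum_square K) (bigID (fun i => 'chi_i \is a linear_char)) /=.
  congr (_ + _)%R; rewrite -card_lin_irr -sumr_const.
  by apply: eq_bigr => i /lin_char1->; rewrite expr1n.
have cardE (kT : finGroupType) (K : {group kT}) :
  #|[pred i | 'chi[K]_i \isn't a linear_char]| =
    (#|classes K| - #|K : K^`(1)%g|)%N.
  rewrite -NirrE -[Nirr K in RHS]card_ord -card_lin_irr.
  rewrite -(cardC [pred i | 'chi[K]_i \is a linear_char]) addKn.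
  exact: eq_card.
have sumG : \sum_(i | 'chi[G]_i \isn't a linear_char) 'chi_i 1%g ^+ 2
         = \sum_(i | 'chi[H]_i \isn't a linear_char) (p ^ 2)%N%:R :> algC.
  have -> : \sum_(i | 'chi[H]_i \isn't a linear_char) (p ^ 2)%N%:R =
      \sum_(i | 'chi[G]_i \isn't a linear_char) (p ^ 2)%N%:R :> algC.
    by rewrite !sumr_const !cardE eqk eqD.
  apply: eq_bigr => i nli; rewrite p2; congr (_ ^+ 2)%R; apply/le_anti.
  by rewrite leG (irr1_pgroup_ge p_pr pG).
have : \sum_(i | 'chi[H]_i \isn't a linear_char)
    ('chi_i 1%g ^+ 2 - (p ^ 2)%N%:R) = 0 :> algC.
  rewrite sumrB -sumG; apply/eqP; rewrite subr_eq0.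
  by have := sumE _ G; rewrite eqo eqD sumE => /addrI/eqP.
move/eqP; rewrite psumr_eq0 => [/allP eq0 i | i nli]; last first.
  rewrite subr_ge0 p2 lerXn2r ?nnegrE ?ler0n ?irr1_pgroup_ge //.
  by rewrite ltW ?irr1_gt0.
have [/lin_char1-> | nli] := boolP ('chi_i \is a linear_char).
  by rewrite ler1n prime_gt0.
have := eq0 i (mem_index_enum i); rewrite nli /= subr_eq0 p2.
by rewrite eqrXn2 ?ler0n // ?(ltW (irr1_gt0 i)) // => /eqP->.
Qed.

(** Take b in the second centre but not in the centre; its centraliser M has
    index p as Z(H) has order p.  Let chi be a faithful irreducible character of
    H.  If its restriction to M had a nonlinear constituent, it would be equal
    to it by comparison of degrees, so b, being central in M, would act as a
    scalar and be central in H.  All constituents are therefore linear and M' is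
    in the kernel of chi. *)
Lemma abelian_index_p_of_irr1_le (gT : finGroupType) (p : nat)
    (H : {group gT}) :
    prime p -> p.-group H -> #|'Z(H)| = p -> ~~ abelian H ->
    (forall i, 'chi[H]_i 1%g <= p%:R)%R ->
  exists M : {group gT}, [/\ M \subset H, abelian M & #|H : M| = p].
Proof.
move=> p_pr pH oZ nabH le_p; have nilH := pgroup_nil pH.
have [b [Hb nZb RbZ]] : exists b,
    [/\ b \in H, b \notin 'Z(H) & [~: [set b], H] \subset 'Z(H)].
  have : ~~ ('Z_2(H) \subset 'Z(H)).
    apply: contra nabH => sZ; have ZQ1 : 'Z(H / 'Z(H)) = 1%g.
      by rewrite -(ucn1 H) -(ucn_central 1) quotientS1 //= ucn1.
    have := trivg_center_pgroup (quotient_pgroup 'Z(H) pH) ZQ1.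
    move/trivgP; rewrite quotient_sub1 ?normal_norm ?center_normal //.
    by move=> sHZ; apply: abelianS sHZ (center_abelian H).
  case/subsetPn=> b; rewrite ucnSnR inE ucn1 => /andP[Hb RbZ] nZb.
  by exists b.
pose M := 'C_H[b]%G.
have sMH : M \subset H := subsetIl _ _.
have oM : #|H : M| = p.
  rewrite index_cent1.
  have le_bH : (#|b ^: H| <= p)%N.
    rewrite -oZ -(card_lcoset _ b); apply: subset_leq_card.
    apply/subsetP=> _ /imsetP[h Hh ->]; rewrite mem_lcoset.
    by rewrite -/(commg b h) (subsetP RbZ) // mem_commg ?set11.
  have : p.-nat #|b ^: H|.
    by rewrite -index_cent1; apply: pnat_dvd pH; apply: dvdn_indexg.
  case/p_natP=> [[|[|j]]] ej; rewrite ej // in le_bH *; last first.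
    move: le_bH; rewrite -{2}(expn1 p) leq_exp2l //; exact: prime_gt1.
  case/negP: nZb; rewrite inE Hb; apply/centP=> h Hh; apply/commgP.
  have : (b ^ h)%g \in b ^: H by apply: memJ_class.
  have: b \in b ^: H by apply: class_refl.
  move/eqP/cards1P: ej => [c ->] /set1P-> /set1P Eh.
  by rewrite commgEl Eh mulVg.
exists M; split=> //.
have cycZ : cyclic 'Z(H) by rewrite prime_cyclic ?oZ.
have [i fi] := pgroup_cyclic_faithful pH cycZ.
have Zi := cfcenter_fful_irr fi.
have pM := pgroupS sMH pH.
have [/existsP[j /andP[Mj nlj]] | ] := boolP [exists j,
    (j \in irr_constt ('Res[M] 'chi_i)) && ('chi_j \isn't a linear_char)].
  have Nr : 'Res[M] 'chi_i \is a character by rewrite cfRes_char ?irr_char.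
  have [S NS defR] := constt_charP _ Nr Mj.
  have : 'Res[M] 'chi_i 1%g = ('chi_j + S)%R 1%g by rewrite -defR.
  rewrite cfRes1 cfunE => def1.
  have S0 : S = 0%R.
    apply/eqP; rewrite -(char1_eq0 NS) eq_le (char1_ge0 NS) andbT.
    rewrite -(lerD2l ('chi_j 1%g)) -def1 addr0.
    by apply: le_trans (le_p i) _; apply: irr1_pgroup_ge nlj.
  have : b \in 'Z(M).
    by rewrite inE inE Hb cent1id; apply/centP=> y /setIP[_ /cent1P].
  rewrite -cap_cfcenter_irr => /bigcapP/(_ j isT).
  have Mb : b \in M by rewrite inE Hb cent1id.
  rewrite irr_cfcenterE // -[in X in X -> _](addr0 'chi_j) -S0 -defR.
  rewrite cfRes1 cfResE //.
  by rewrite -irr_cfcenterE // Zi (negPf nZb).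
rewrite negb_exists => /forallP lin.
rewrite abelianE; apply/commG1P/trivgP; rewrite -/(derived_at 1 M).
have sDk : M^`(1)%g \subset cfker ('Res[M] 'chi_i).
  rewrite cfkerE ?cfRes_char ?irr_char // subsetI der_sub /=.
  apply/bigcapsP=> j Mj; rewrite -lin_irr_der1; have := lin j.
  by rewrite Mj negbK.
apply: subset_trans (subset_trans sDk _) fi.
by rewrite cfker_Res ?irr_char // subsetIr.
Qed.

(** * Sums invariant under a p-group *)

(** The other orbits have length divisible by p, and f is constant on each. *)
Lemma sum_fixed_points (V : zmodType) (p : nat) (aT : finGroupType)
    (T : finType) (to : {action aT &-> T})
    (P : {group aT}) (S : {set T}) (f : T -> V) :
    (forall v : V, v *+ p = 0) ->
    p.-group P -> [acts P, on S | to] ->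
    (forall x a, x \in S -> a \in P -> f (to x a) = f x) ->
  \sum_(x in S) f x = \sum_(x in 'Fix_(S | to)(P)) f x.
Proof.
move=> pV0 pP actsP invf.
rewrite (big_setID 'Fix_to(P)) /= [X in _ + X](_ : _ = 0) ?addr0 //.
have actsD : [acts P, on S :\: 'Fix_to(P) | to].
  rewrite actsD // (subset_trans (normG P)) //.
  by have := acts_subnorm_fix to P; rewrite !setTI.
rewrite (set_partition_big _ (orbit_partition actsD)) /=.
rewrite big1 // => _ /imsetP[x /setDP[Sx nFx] ->].
rewrite (eq_bigr (fun=> f x)) => [|_ /orbitP[a Pa <-]]; last exact: invf.
rewrite sumr_const.
have /p_natP[[|k] ek] : p.-nat #|orbit to P x|.
- by rewrite card_orbit; apply: pnat_dvd pP; apply: dvdn_indexg.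
- by case/negP: nFx; apply/orbit1P/card_orbit1.
by rewrite ek expnS mulrnA pV0 mul0rn.
Qed.

(** The rotation of the p-tuples generates a group of order p whose fixed points
    are the constant tuples. *)
Lemma sum_rotation (V : zmodType) (T : finType) (p : nat)
    (f : {ffun 'I_p -> T} -> V) :
    prime p -> (forall v : V, v *+ p = 0) ->
    (forall t : {ffun 'I_p -> T}, f [ffun i => t (ordS i)] = f t) ->
  \sum_t f t = \sum_x f [ffun => x].
Proof.
move=> p_pr pV0 fS; case: p p_pr => // n p_pr in f pV0 fS *.
have sI : injective (fun t : {ffun 'I_n.+1 -> T} => [ffun i => t (ordS i)]).
  move=> t t' /ffunP e; apply/ffunP=> i.
  by have := e (ord_pred i); rewrite !ffunE ord_predK.
pose s := perm sI.
have sX k t i : ((s ^+ k)%g t) i = t (iter k (@ordS _) i).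
  elim: k i => [|k IHk] i; first by rewrite expg0 perm1.
  by rewrite expgSr permM permE ffunE IHk iterSr.
have ordX k (i : 'I_n.+1) : iter k (@ordS _) i = ((i + k) %% n.+1)%N :> nat.
  elim: k => [|k IHk]; first by rewrite addn0 modn_small.
  by rewrite iterS /= IHk -addn1 modnDml addn1 addnS.
have sp : (s ^+ n.+1 = 1)%g.
  apply/permP=> t; apply/ffunP=> i; rewrite sX perm1; congr (t _).
  by apply: val_inj; rewrite [LHS]ordX modnDr modn_small.
have ps : n.+1.-group <[s]>%g.
  apply/pgroupP=> q q_pr q_dvd; rewrite inE /= -(dvdn_prime2 q_pr) //.
  by apply: dvdn_trans q_dvd _; rewrite -orderE order_dvdn sp.
have := @sum_fixed_points V n.+1 _ _ 'P%act <[s]>%G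
  [set: {ffun 'I_n.+1 -> T}] f pV0 ps.
rewrite big_set /= => ->; last 2 first.
- by apply/actsP=> g _ x; rewrite !inE.
- move=> t _ _ /cycleP[k ->]; rewrite /= apermE.
  elim: k => [|k IHk]; first by rewrite expg0 perm1.
  by rewrite expgSr permM permE fS.
rewrite (reindex_onto (fun x : T => [ffun => x]) (fun t => t ord0)) /=.
  apply: eq_bigl => x; rewrite ffunE eqxx andbT setTI.
  apply/afixP=> _ /cycleP[k ->]; rewrite /= apermE; apply/ffunP=> i.
  by rewrite sX !ffunE.
move=> t; rewrite setTI => /afixP fix_t; apply/ffunP=> i; rewrite ffunE.
have /ffunP/(_ ord0) := fix_t (s ^+ i)%g (mem_cycle s i).
rewrite /= apermE sX => <-; congr (t _).
by apply: ord_inj; rewrite ordX add0n modn_small.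
Qed.

(** * Group bases of an algebra *)

Lemma span_ind (F : fieldType) (V : vectType F) (P : V -> Prop) (X : seq V) :
  P 0 -> (forall a u v, P u -> P v -> P (a *: u + v)) ->
  (forall u, u \in X -> P u) -> forall u, u \in <<X>>%VS -> P u.
Proof.
move=> P0 PD PX u; rewrite -[X]/(tval (in_tuple X)) => /coord_span->.
by elim/big_rec: _ => // i y _; apply/PD/PX/mem_nth.
Qed.

Lemma prodv_ind (F : fieldType) (A : falgType F) (P : A -> Prop)
    (U V : {vspace A}) :
  P 0 -> (forall a u v, P u -> P v -> P (a *: u + v)) ->
  (forall u v, u \in U -> v \in V -> P (u * v)) ->
  forall w, w \in (U * V)%VS -> P w.
Proof.
move=> P0 PD PM w; rewrite unlock; move: w; apply: span_ind => // w.
by case/allpairsP=> [[u v] /= [Uu Vv ->]]; apply: PM; apply: vbasis_mem.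
Qed.

Section GroupBasis.
Variables (F : fieldType) (A : falgType F) (G : finGroupType).
Implicit Types (b : G -> A) (x y z : G) (u v w : A).

Record group_basis b : Prop := GroupBasis {
  group_basis1 : b 1%g = 1;
  group_basisM : {morph b : x y / (x * y)%g >-> x * y};
  group_basisP : basis_of fullv (codom b) }.

Variable b : G -> A.
Hypothesis bG : group_basis b.

Let b1 := group_basis1 bG.
Let bM := group_basisM bG.

Definition gcoef x u : F := coord (codom_tuple b) (enum_rank x) u.

Lemma gcoef_sum u : u = \sum_x gcoef x u *: b x.
Proof.
have /andP[/eqP sp _] := group_basisP bG.
have u_sp : u \in <<codom_tuple b>>%VS by rewrite sp memvf.
rewrite {1}(coord_span u_sp) (reindex _ (onW_bij _ (@enum_rank_bij G))) /=.
apply: eq_bigr => x _; rewrite /gcoef; congr (_ *: _).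
by rewrite (nth_map x) -?cardE ?ltn_ord // nth_enum_rank.
Qed.

Lemma gcoef_basis x y : gcoef x (b y) = (x == y)%:R.
Proof.
have /andP[_ fr] := group_basisP bG.
have <- : (codom_tuple b)`_(enum_rank y) = b y.
  by rewrite (nth_map x) -?cardE ?ltn_ord // nth_enum_rank.
by rewrite /gcoef coord_free // (inj_eq enum_rank_inj) eq_sym.
Qed.

Definition gext_fun (V : vectType F) (v : G -> V) u := \sum_x gcoef x u *: v x.

Fact gext_fun_linear (V : vectType F) (v : G -> V) : linear (gext_fun v).
Proof.
move=> a u w; rewrite scaler_sumr -big_split; apply: eq_bigr => x _ /=.
by rewrite /gcoef linearP scalerDl scalerA.
Qed.

HB.instance Definition _ (V : vectType F) (v : G -> V) :=
  GRing.isLinear.Build F A V _ (gext_fun v) (gext_fun_linear v).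

Definition gext (V : vectType F) (v : G -> V) : 'Hom(A, V) :=
  linfun (gext_fun v).

Lemma gextE (V : vectType F) (v : G -> V) x : gext v (b x) = v x.
Proof.
rewrite lfunE /= /gext_fun (bigD1 x) //= gcoef_basis eqxx scale1r.
rewrite big1 ?addr0 // => y nyx.
by rewrite gcoef_basis (negPf nyx) scale0r.
Qed.

Lemma hom_basis_ext (V : vectType F) (f g : 'Hom(A, V)) :
  (forall x, f (b x) = g (b x)) -> f = g.
Proof.
move=> eqfg; apply/lfunP=> u; rewrite (gcoef_sum u) !linear_sum.
by apply: eq_bigr => x _; rewrite !linearZ /= eqfg.
Qed.

Lemma basis_inj : injective b.
Proof.
move=> x y /(congr1 (gcoef x)); rewrite !gcoef_basis eqxx.
by case: eqP => // _ /eqP; rewrite oner_eq0.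
Qed.

Lemma dim_span_basis (X : {set G}) : \dim <<[seq b x | x in X]>> = #|X|.
Proof.
have /andP[_ fr] := group_basisP bG.
apply: etrans (size_image b [in X]); apply/eqP; rewrite -/(free _).
have -> : [seq b x | x in X] = filter [in [seq b x | x in X]] (codom b).
  rewrite /codom /image_mem filter_map; congr map.
  rewrite enumT; apply: eq_filter => x /=.
  by rewrite [RHS](mem_map basis_inj) mem_enum.
exact: filter_free.
Qed.

Lemma basis_fullv (W : {vspace A}) : (forall x, b x \in W) -> W = fullv.
Proof.
move=> bW; apply/vspaceP => u.
by rewrite memvf (gcoef_sum u) memv_suml // => x _; rewrite memvZ.
Qed.

Lemma basisX x n : b (x ^+ n)%g = b x ^+ n.
Proof. by elim: n => [|n IHn]; rewrite ?b1 // expgS bM IHn exprS. Qed.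

(** For r idempotent this is the linearisation of the projection of G onto the
    parts of a partition, each part being represented by one of its elements; it
    takes values in A, so that no quotient algebra is needed. *)
Definition collapse (r : G -> G) : 'End(A) := gext (b \o r).

Lemma collapseE r x : collapse r (b x) = b (r x).
Proof. exact: gextE. Qed.

Lemma dim_collapse r (X : {set G}) :
  \dim (collapse r @: <<[seq b x | x in X]>>) = #|r @: X|.
Proof.
rewrite -dim_span_basis limg_span -map_comp; congr (\dim _).
apply: eq_span => u; apply/mapP/imageP => [[x] | [_ /imsetP[x Xx ->] ->]].
  by rewrite mem_enum => Xx ->; exists (r x); rewrite ?imset_f //= collapseE.
by exists x; rewrite ?mem_enum //= collapseE.
Qed.

(** This describes the kernel by linear forms only, which makes it comparable
    for two group bases of the same algebra. *)
Lemma lker_collapseP r u : (forall x, r (r x) = r x) ->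
  reflect (forall phi : 'Hom(A, F^o),
              (forall x y, r x = r y -> phi (b x) = phi (b y)) -> phi u = 0)
          (u \in lker (collapse r)).
Proof.
move=> rr; rewrite memv_ker; apply: (iffP eqP) => [ru0 phi phir | all0].
  have -> : phi = (phi \o collapse r)%VF.
    by apply: hom_basis_ext => x; rewrite comp_lfunE collapseE; apply: phir.
  by rewrite comp_lfunE ru0 linear0.
(* the coefficient at x of collapse r u, as a linear form in u *)
rewrite (gcoef_sum (collapse r u)) big1 // => x _.
have := all0 (gext (fun y => (x == r y)%:R : F^o)).
have -> : gext (fun y => (x == r y)%:R : F^o) u = gcoef x (collapse r u).
  rewrite (gcoef_sum u) !linear_sum /=; rewrite /gcoef linear_sum.
  by apply: eq_bigr => y _; rewrite !linearZ /= gextE collapseE -gcoef_basis.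
by move=> ->; rewrite ?scale0r // => y z eqr; rewrite !gextE eqr.
Qed.

End GroupBasis.

(** * Conjugacy classes, cosets of the commutator subgroup and centre *)

Definition coset_rep (gT : finGroupType) (N : {set gT}) (x : gT) : gT :=
  repr (x *: N)%g.
Definition class_rep (gT : finGroupType) (x : gT) : gT :=
  repr (x ^: [set: gT])%g.

Prenex Implicits class_rep coset_rep.

Local Notation der1_rep gT := (@coset_rep gT [set: gT]^`(1)%G).

Section Rep.
Variable gT : finGroupType.
Implicit Types (N : {group gT}) (x y : gT).

Lemma coset_repP N x y : (coset_rep N x = coset_rep N y) <-> (x^-1 * y \in N)%g.
Proof.
have mem z : (coset_rep N z \in z *: N)%g.
  exact: mem_repr (lcoset_refl N z).
rewrite -mem_lcoset; split=> [eqr | /lcoset_eqP e]; last first.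
  by rewrite /coset_rep e.
have := mem x; rewrite eqr => /lcoset_eqP <-.
by have := mem y => /lcoset_eqP ->; apply: lcoset_refl.
Qed.

Lemma coset_repK N x : coset_rep N (coset_rep N x) = coset_rep N x.
Proof.
apply/esym/coset_repP; rewrite -mem_lcoset.
exact: mem_repr (lcoset_refl N x).
Qed.

Lemma card_coset_rep N (K : {group gT}) : #|coset_rep N @: K| = #|K : N|.
Proof.
rewrite -card_lcosets /lcosets.
have -> : coset_rep N @: K = repr @: (lcoset N @: K).
  by rewrite -imset_comp; apply: eq_imset => x; rewrite /= lcosetE.
apply: card_in_imset => _ _ /imsetP[x _ ->] /imsetP[y _ ->].
rewrite !lcosetE => /coset_repP; rewrite -mem_lcoset.
by move/lcoset_eqP.
Qed.

Lemma class_repP x y : (class_rep x = class_rep y) <-> y \in (x ^: [set: gT])%g.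
Proof.
have mem z : (class_rep z \in z ^: [set: gT])%g.
  exact: mem_repr (class_refl _ z).
split=> [eqr | /class_eqP e]; last by rewrite /class_rep e.
have := mem x; rewrite eqr => /class_eqP <-.
by have := mem y => /class_eqP ->; apply: class_refl.
Qed.

Lemma class_repK x : class_rep (class_rep x) = class_rep x.
Proof. by apply/esym/class_repP; apply: mem_repr (class_refl _ x). Qed.

Lemma card_class_rep : #|class_rep @: [set: gT]| = #|classes [set: gT]|.
Proof.
have -> : class_rep @: [set: gT] = repr @: (classes [set: gT]).
  by rewrite -imset_comp.
apply: card_in_imset => _ _ /imsetP[x _ ->] /imsetP[y _ ->] /class_repP.
by move/class_eqP.
Qed.

Lemma class_rep_center x : x \in 'Z([set: gT])%g -> class_rep x = x.
Proof.
case/centerP=> _ cx; apply/set1P.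
suff <- : (x ^: [set: gT])%g = [set x] by apply: mem_repr (class_refl _ x).
apply/setP=> y; apply/imsetP/set1P => [[g Gg ->] | ->].
  by rewrite conjgE cx ?inE // mulKg.
by exists 1%g; rewrite ?conjg1.
Qed.

End Rep.

Section Forms.
Variables (F : fieldType) (A : falgType F).
Implicit Types (u v w : A) (phi : 'Hom(A, F^o)).

Definition trace_form phi := forall u v, phi (u * v) = phi (v * u).
Definition comm_form phi := forall u v w, phi (u * v * w) = phi (v * u * w).

Variables (G : finGroupType) (b : G -> A).
Hypothesis bG : group_basis b.
Let b1 := group_basis1 bG.
Let bM := group_basisM bG.

Lemma basis_elim (P : A -> Prop) :
  P 0 -> (forall a u v, P u -> P v -> P (a *: u + v)) -> (forall x, P (b x)) ->
  forall u, P u.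
Proof.
move=> P0 PD Pb u; rewrite (gcoef_sum bG u).
by elim/big_rec: _ => // x w _; apply: PD.
Qed.

Lemma trace_formP phi :
  trace_form phi <->
  (forall x y, class_rep x = class_rep y -> phi (b x) = phi (b y)).
Proof.
split=> [tr x y /class_repP/imsetP[g _ ->] | cl].
  by rewrite conjgE bM tr -bM mulgK.
elim/basis_elim => [v | a u w IHu IHw v | x]; rewrite ?mul0r ?mulr0 //.
  by rewrite mulrDl mulrDr -scalerAl -scalerAr !linearP /= IHu IHw.
elim/basis_elim => [| a u w IHu IHw | y]; rewrite ?mul0r ?mulr0 //.
  by rewrite mulrDl mulrDr -scalerAl -scalerAr !linearP /= IHu IHw.
rewrite -!bM; apply/cl/class_repP/imsetP; exists x; rewrite ?inE //.
by rewrite conjgE -!mulgA mulKg.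
Qed.

(** Replacing x y by y x in front of any element is left multiplication by a
    commutator; invariance under these is invariance under G', and left and
    right cosets of G' agree. *)
Lemma comm_formP phi :
  comm_form phi <->
  (forall x y, der1_rep G x = der1_rep G y -> phi (b x) = phi (b y)).
Proof.
have nD (x : G) : x \in 'N([set: G]^`(1)%g).
  by rewrite (subsetP (der_norm 1 _)) ?inE.
split=> [cf x y /coset_repP Dxy | cl].
  have phiD c z : c \in [set: G]^`(1)%g -> phi (b (c * z)%g) = phi (b z).
    case/gen_prodgP=> n [d dR ->]; elim: n d dR => [|n IHn] d dR.
      by rewrite big_ord0 mul1g.
    rewrite big_ord_recl -mulgA; have /imset2P[g h _ _ ->] := dR ord0.
    have -> : ([~ g, h] * (\prod_(i < n) d (lift ord0 i) * z) =
        g^-1 * h^-1 * (g * h * (\prod_(i < n) d (lift ord0 i) * z)))%g.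
      by rewrite /commg conjgE !mulgA.
    rewrite !(bM _ (_ * _)%g) !bM cf -!bM -!mulgA !mulKg.
    by apply: IHn => i; apply: dR.
  have -> : y = ((x^-1 * y) ^ x^-1 * x)%g.
    by rewrite conjgE invgK !mulgA mulgV mul1g mulgVK.
  by rewrite phiD // memJ_norm.
elim/basis_elim => [v w | a u1 u2 IH1 IH2 v w | x]; rewrite ?(mul0r, mulr0) //.
  by rewrite !(mulrDl, mulrDr) -!(scalerAl, scalerAr) !linearP /= IH1 IH2.
elim/basis_elim => [w | a u1 u2 IH1 IH2 w | y]; rewrite ?(mul0r, mulr0) //.
  by rewrite !(mulrDl, mulrDr) -!(scalerAl, scalerAr) !linearP /= IH1 IH2.
elim/basis_elim => [| a u1 u2 IH1 IH2 | z]; rewrite ?(mul0r, mulr0) //.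
  by rewrite !mulrDr -!scalerAr !linearP /= IH1 IH2.
rewrite -!bM; apply/cl/coset_repP.
have -> : ((x * y * z)^-1 * (y * x * z) = [~ y, x] ^ z)%g.
  by rewrite /commg !conjgE !invMg !mulgA.
by rewrite memJ_norm // mem_commg ?inE.
Qed.

Lemma lker_class_repP u :
  reflect (forall phi, trace_form phi -> phi u = 0)
          (u \in lker (collapse b class_rep)).
Proof.
by apply: (iffP (lker_collapseP bG u (@class_repK G))) => H phi /trace_formP;
   apply: H.
Qed.

Lemma lker_der1_repP u :
  reflect (forall phi, comm_form phi -> phi u = 0)
          (u \in lker (collapse b (der1_rep G))).
Proof.
by apply: (iffP (lker_collapseP bG u (coset_repK _))) => H phi /comm_formP;
   apply: H.
Qed.

Lemma basis_centerP u :
  reflect (forall x, b x * u = u * b x) (u \in 'Z({:A})%VS).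
Proof.
rewrite memv_cap memvf; apply: (iffP centvP) => [cu x | cu v _].
  by rewrite cu ?memvf.
elim/basis_elim: v => [|a v w IHv IHw|x]; rewrite ?mul0r ?mulr0 //.
by rewrite mulrDl mulrDr -scalerAl -scalerAr IHv IHw.
Qed.

End Forms.

Section Center.
Variables (F : fieldType) (A : falgType F) (p : nat).
Hypothesis charF : p \in [pchar F].
Variables (G : finGroupType) (b : G -> A).
Hypothesis bG : group_basis b.
Hypothesis pG : p.-group [set: G].
Let b1 := group_basis1 bG.
Let bM := group_basisM bG.
Implicit Types (u v w : A).

Lemma pchar_falg : p \in [pchar A].
Proof. by rewrite pchar_lalg. Qed.

Lemma mulrn_pchar (v : A) : v *+ p = 0.
Proof. by rewrite -scaler_nat pcharf0 // scale0r. Qed.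

Lemma gcoef_conj u x g :
  gcoef b (x ^ g)%g (b g^-1%g * u * b g) = gcoef b x u.
Proof.
move: u; apply: (basis_elim bG) => [|a u v IHu IHv|y].
- by rewrite mulr0 mul0r /gcoef !linear0.
- rewrite mulrDr mulrDl -scalerAr -scalerAl; rewrite /gcoef in IHu IHv *.
  by rewrite !linearP /= IHu IHv.
by rewrite -!bM -mulgA -conjgE !(gcoef_basis bG) (inj_eq (conjg_inj g)).
Qed.

(** A central element has coefficients constant on conjugacy classes, so
    sum_fixed_points applies to conjugation: only the coefficients on Z(G)
    survive. *)
Lemma collapse_center (r : G -> G) : (forall x g, r (x ^ g)%g = r x) ->
  (collapse b r @: 'Z({:A}) =
   collapse b r @: <<[seq b x | x in 'Z([set: G])%g]>>)%VS.
Proof.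
move=> rJ; apply/eqP; rewrite eqEsubv; apply/andP; split; last first.
  apply: limgS; apply/span_subvP=> _ /imageP[z /centerP[_ cz] ->].
  by apply/(basis_centerP bG) => x; rewrite -!bM cz ?inE.
apply/subvP=> _ /memv_imgP[u /(basis_centerP bG) cu ->].
rewrite {1}(gcoef_sum bG u) linear_sum /=.
have := @sum_fixed_points A p G G 'J%act [set: G]%G [set: G]
  (fun x => collapse b r (gcoef b x u *: b x)) mulrn_pchar pG.
rewrite big_set /= => ->; last 2 first.
- by apply/actsP=> g _ x; rewrite !inE.
- move=> x g _ _ /=; rewrite !linearZ /= !collapseE // rJ; congr (_ *: _).
  rewrite -[RHS](gcoef_conj _ x g) -mulrA -cu mulrA -bM mulVg b1 mul1r //.
rewrite memv_suml // => x /setIP[_ /afixP cx].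
rewrite memv_img // memvZ // memv_span //.
apply/imageP; exists x => //.
apply/centerP; split; rewrite ?inE // => g _.
have := cx g (in_setT g); rewrite /= => /conjg_fixP/commgP. by [].
Qed.

Lemma dim_lker_collapse (W : {vspace A}) (r : G -> G) (X : {set G}) :
  (collapse b r @: W = collapse b r @: <<[seq b x | x in X]>>)%VS ->
  (\dim (W :&: lker (collapse b r)) + #|r @: X| = \dim W)%N.
Proof. by move=> eqW; rewrite -(dim_collapse bG) -eqW limg_ker_dim. Qed.

Lemma span_basisT : (<<[seq b x | x in [set: G]]>> = {:A})%VS.
Proof.
by apply: (basis_fullv bG) => x; rewrite memv_span // image_f ?inE.
Qed.

End Center.

(** * Numerical invariants of a group basis *)

Section Invariants.
Variables (F : fieldType) (A : falgType F) (p : nat).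
Hypothesis charF : p \in [pchar F].
Variables (G H : finGroupType) (b : G -> A) (c : H -> A).
Hypotheses (bG : group_basis b) (cH : group_basis c).
Hypotheses (pG : p.-group [set: G]) (pH : p.-group [set: H]).

Lemma lker_class_rep_eq :
  lker (collapse b class_rep) = lker (collapse c class_rep).
Proof.
by apply/vspaceP=> u; apply/(lker_class_repP bG)/(lker_class_repP cH).
Qed.

Lemma lker_der1_rep_eq :
  lker (collapse b (der1_rep G)) =
  lker (collapse c (der1_rep H)).
Proof.
by apply/vspaceP=> u; apply/(lker_der1_repP bG)/(lker_der1_repP cH).
Qed.

Lemma card_group_eq : #|[set: G]| = #|[set: H]|.
Proof. by rewrite -(dim_span_basis bG) -(dim_span_basis cH) !span_basisT. Qed.

Lemma card_classes_eq : #|classes [set: G]| = #|classes [set: H]|.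
Proof.
have dG := dim_lker_collapse bG (r := class_rep)
  (congr1 _ (esym (span_basisT bG))).
have dH := dim_lker_collapse cH (r := class_rep)
  (congr1 _ (esym (span_basisT cH))).
by move: dG; rewrite -dH lker_class_rep_eq !card_class_rep => /addnI.
Qed.

Lemma index_der1_eq :
  #|[set: G] : [set: G]^`(1)| = #|[set: H] : [set: H]^`(1)|.
Proof.
have dG := dim_lker_collapse bG (r := der1_rep G)
  (congr1 _ (esym (span_basisT bG))).
have dH := dim_lker_collapse cH (r := der1_rep H)
  (congr1 _ (esym (span_basisT cH))).
move: dG; rewrite -dH lker_der1_rep_eq => /addnI.
by rewrite !(@card_coset_rep _ _ [set: _]%G).
Qed.

Lemma class_repJ (gT : finGroupType) (x g : gT) :
  class_rep (x ^ g)%g = class_rep x.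
Proof. by apply/esym/class_repP; rewrite memJ_class ?inE. Qed.

Lemma der1_repJ (gT : finGroupType) (x g : gT) :
  der1_rep gT (x ^ g)%g = der1_rep gT x.
Proof. by apply/esym/coset_repP; rewrite -commgEl mem_commg ?inE. Qed.

Lemma card_center_eq : #|'Z([set: G])%g| = #|'Z([set: H])%g|.
Proof.
have dG := dim_lker_collapse bG (collapse_center charF bG pG (@class_repJ G)).
have dH := dim_lker_collapse cH (collapse_center charF cH pH (@class_repJ H)).
move: dG; rewrite -dH lker_class_rep_eq => /addnI.
have im (gT : finGroupType) : class_rep @: 'Z([set: gT]) = 'Z([set: gT])%g.
  rewrite -[RHS]imset_id; apply: eq_in_imset => x; exact: class_rep_center.
by rewrite !im.
Qed.

Lemma index_center_der1_eq :
  #|'Z([set: G]) : [set: G]^`(1)| = #|'Z([set: H]) : [set: H]^`(1)|.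
Proof.
have dG := dim_lker_collapse bG (collapse_center charF bG pG (@der1_repJ G)).
have dH := dim_lker_collapse cH (collapse_center charF cH pH (@der1_repJ H)).
move: dG; rewrite -dH lker_der1_rep_eq => /addnI.
by rewrite !card_coset_rep.
Qed.

Lemma card_der1_eq : #|[set: G]^`(1)%g| = #|[set: H]^`(1)%g|.
Proof.
have := card_group_eq; rewrite -(Lagrange (der_sub 1 [set: G])).
rewrite -(Lagrange (der_sub 1 [set: H])) index_der1_eq => /eqP.
by rewrite eqn_pmul2r ?indexg_gt0 // => /eqP.
Qed.

Lemma card_center_der1_eq :
  #|'C_([set: G]^`(1))([set: G])%g| = #|'C_([set: H]^`(1))([set: H])%g|.
Proof.
have capE (gT : finGroupType) :
  'C_([set: gT]^`(1))([set: gT])%g = 'Z([set: gT])%g :&: [set: gT]^`(1)%g.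
  by rewrite setIC /center setTI.
have := card_center_eq; rewrite -(LagrangeI 'Z([set: G]) [set: G]^`(1)).
rewrite -(LagrangeI 'Z([set: H]) [set: H]^`(1)) index_center_der1_eq => /eqP.
by rewrite eqn_pmul2r ?indexg_gt0 // !capE => /eqP.
Qed.

End Invariants.

(** * The augmentation *)

Section Local.
Variables (F : fieldType) (A : falgType F) (p : nat).
Hypothesis charF : p \in [pchar F].
Variables (G : finGroupType) (b : G -> A).
Hypothesis bG : group_basis b.
Hypothesis pG : p.-group [set: G].
Let b1 := group_basis1 bG.
Let bM := group_basisM bG.
Implicit Types (u v w : A).

Definition aug : 'Hom(A, F^o) := gext b (fun _ => 1 : F^o).

Lemma aug_basis x : aug (b x) = 1.
Proof. exact: gextE. Qed.

Lemma aug1 : aug 1 = 1.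
Proof. by rewrite -b1 aug_basis. Qed.

Lemma augM u v : aug (u * v) = aug u * aug v.
Proof.
move: u v; apply: (basis_elim bG) => [v | a u w IHu IHw v | x].
- by rewrite mul0r linear0 mul0r.
- by rewrite mulrDl -scalerAl !linearP /= IHu IHw mulrDl scalerAl.
apply: (basis_elim bG) => [| a u w IHu IHw | y].
- by rewrite mulr0 linear0 mulr0.
- by rewrite mulrDr -scalerAr !linearP /= IHu IHw mulrDr -scalerAr.
by rewrite -bM !aug_basis mulr1.
Qed.

Lemma aug0_sum u : aug u = 0 -> u = \sum_x gcoef b x u *: (b x - 1).
Proof.
move=> augu; under eq_bigr do rewrite scalerBr.
rewrite sumrB -(gcoef_sum bG) -scaler_suml.
have -> : \sum_x gcoef b x u = 0; last by rewrite scale0r subr0.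
rewrite -[RHS]augu {2}(gcoef_sum bG u) linear_sum; apply: eq_bigr => x _.
by rewrite linearZ /= aug_basis [_ *: _]mulr1.
Qed.

(** The image of a group element under phi is a root of unity of order a power
    of p in a field of characteristic p, so it is 1. *)
Lemma aug_unique (phi : 'Hom(A, F^o)) :
  phi 1 = 1 -> (forall u v, phi (u * v) = phi u * phi v) -> phi = aug.
Proof.
move=> phi1 phiM; apply: (hom_basis_ext bG) => x; rewrite aug_basis.
have phiX n : phi (b x ^+ n) = phi (b x) ^+ n.
  by elim: n => [|n IHn]; rewrite ?phi1 // !exprS phiM IHn.
have /p_natP[k ek] := mem_p_elt pG (in_setT x).
set t : F := phi (b x).
have t1 : t ^+ (p ^ k) = 1 by rewrite /t -phiX -(basisX bG) -ek expg_order b1.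
have nat_k : [pchar F].-nat (p ^ k)%N.
  by rewrite pnatX (eq_pnat _ (pcharf_eq charF)) pnat_id ?(pcharf_prime charF).
have := exprDn_pchar (t - 1) 1 nat_k; rewrite subrK expr1n t1 => /eqP.
rewrite -subr_eq0 opprD addrCA subrr addr0 oppr_eq0 expf_eq0 subr_eq0.
by case/andP=> _ /eqP.
Qed.

Lemma basis_sub1Xp x k : (b x - 1) ^+ (p ^ k) = b (x ^+ (p ^ k))%g - 1.
Proof.
have charA : p \in [pchar A] by apply: pchar_falg.
elim: k => [|k IHk]; first by rewrite expr1 expg1.
rewrite expnSr exprM IHk -(pFrobenius_autE charA).
rewrite pFrobenius_autB_comm ?pFrobenius_aut1; last exact: commr1.
by rewrite pFrobenius_autE -(basisX bG) expgM.
Qed.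

(** Climb a chain of subgroups with indices p.  If K = M <x> and w is fixed by
    the normal subgroup M, then so are all (x - 1) ^ j w; the last nonzero one
    among them is fixed by x too. *)
Lemma left_fixed_vector (K : {group G}) u : u != 0 ->
  exists a, a * u != 0 /\ forall k, k \in K -> b k * (a * u) = a * u.
Proof.
have [n] := ubnP #|K|; elim: n K => // n IHn K leKn nzu.
have pK : p.-group K := pgroupS (subsetT K) pG.
have [-> | ntK] := eqsVneq K 1%g.
  by exists 1; split=> [|_ /set1P->]; rewrite ?b1 !mul1r.
have [KM|[M maxM _]] := maximal_exists (sub1G K).
  by rewrite -KM eqxx in ntK.
have [a [nza fixa]] : exists a,
    a * u != 0 /\ forall k, k \in M -> b k * (a * u) = a * u.
  by apply: IHn; rewrite // (leq_trans (proper_card (maxgroupp maxM))).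
have nMK : M <| K := p_maximal_normal pK maxM.
have /properP[sMK [x Kx nMx]] := maxgroupp maxM.
pose w j := (b x - 1) ^+ j * (a * u).
have wS j : w j.+1 = b x * w j - w j by rewrite /w exprS -mulrA mulrBl mul1r.
have wM j k : k \in M -> b k * w j = w j.
  elim: j k => [|j IHj] k Mk; first by rewrite /w expr0 mul1r fixa.
  rewrite wS mulrBr (IHj k) //; congr (_ - _).
  have -> : b k * (b x * w j) = b x * (b (k ^ x)%g * w j).
    by rewrite !mulrA -!bM -conjgC.
  by rewrite IHj // memJ_norm // (subsetP (normal_norm nMK)).
have [j wj0] : exists j, w j == 0.
  have /p_natP[k ek] := mem_p_elt pG (in_setT x).
  exists (p ^ k)%N; rewrite /w.
  by rewrite basis_sub1Xp -ek expg_order b1 subrr mul0r.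
have [[|i] wi0 min_i] := ex_minnP (ex_intro (fun j => w j == 0) j wj0).
  by rewrite /w mul1r (negPf nza) in wi0.
exists ((b x - 1) ^+ i * a); rewrite -mulrA -/(w i).
split=> [|k]; first by apply/negP=> /min_i; rewrite ltnn.
have wx : b x * w i = w i.
  by apply/eqP; rewrite -subr_eq0 -wS.
have <- : (M * <[x]>)%g = K.
  by apply: mulg_normal_maximal; rewrite ?cycle_subG.
case/mulsgP=> m _ Mm /cycleP[l ->] ->; rewrite bM -mulrA.
have -> : b (x ^+ l)%g * w i = w i; last exact: wM.
by elim: l => [|l IHl]; rewrite ?b1 ?mul1r // expgS bM -mulrA IHl.
Qed.

Lemma gcoef_mull x g u : gcoef b x (b g * u) = gcoef b (g^-1 * x)%g u.
Proof.
move: u; apply: (basis_elim bG) => [|a u v IHu IHv|y].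
- by rewrite mulr0 /gcoef !linear0.
- rewrite mulrDr -scalerAr; rewrite /gcoef in IHu IHv *.
  by rewrite !linearP /= IHu IHv.
rewrite -!bM !(gcoef_basis bG); congr (_%:R); congr nat_of_bool.
by apply/eqP/eqP => [->|<-]; rewrite ?mulKg ?mulKVg.
Qed.

(** If y u = 0 with y nonzero, some multiple a y is nonzero and fixed by left
    translations, so it is a multiple of the sum of all group elements, on which
    right multiplication by u is multiplication by aug u.  Hence right
    multiplication by u is injective if aug u is not 0. *)
Lemma aug_unit u : aug u != 0 -> u \is a GRing.unit.
Proof.
move=> nzu; have inj_u : lker (amulr u) == 0%VS.
  rewrite -subv0; apply/subvP=> y; rewrite memv_ker lfunE /= memv0 => /eqP yu0.
  apply/negPn/negP=> nzy.
  have [a []] := left_fixed_vector [set: G] nzy.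
  set w := a * y => nzw fixw.
  have defw : w = gcoef b 1%g w *: \sum_x b x.
    rewrite {1}(gcoef_sum bG w) scaler_sumr; apply: eq_bigr => x _.
    congr (_ *: _); rewrite -(fixw x (in_setT x)) {2}/w gcoef_mull mulVg.
    by rewrite -/w fixw ?inE.
  have : w * u = 0 by rewrite /w -mulrA yu0 mulr0.
  have su : (\sum_x b x) * u = aug u *: \sum_x b x.
    move: u {nzu yu0}; apply: (basis_elim bG) => [|d v v' IHv IHv'|g].
    - by rewrite mulr0 linear0 scale0r.
    - by rewrite mulrDr -scalerAr linearP /= IHv IHv' scalerDl scalerA.
    rewrite aug_basis scale1r mulr_suml [RHS](reindex_inj (mulIg g)) /=.
    by apply: eq_bigr => x _; rewrite bM.
  rewrite defw -scalerAl su scalerA mulrC -scalerA -defw => /eqP.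
  by rewrite scaler_eq0 (negPf nzu) (negPf nzw).
have /memv_imgP[v _ vu] : 1 \in limg (amulr u).
  by rewrite (lker0_limgf inj_u) memvf.
rewrite lfunE /= in vu.
apply/unitrP; exists v; split=> //; apply: (lker0P inj_u).
by rewrite !lfunE /= mul1r -mulrA -vu mulr1.
Qed.

Lemma lker_coset_rep_mem (N : {group G}) n u :
  n \in N -> u * (b n - 1) \in lker (collapse b (coset_rep N)).
Proof.
move=> Nn; move: u; apply: (basis_elim bG) => [|a u v IHu IHv|x].
- by rewrite mul0r mem0v.
- by rewrite mulrDl -scalerAl memvD ?memvZ.
rewrite mulrBr mulr1 -bM memv_ker linearB /= !(collapseE bG).
rewrite (_ : coset_rep N _ = coset_rep N x) ?subrr //.
by apply/esym/coset_repP; rewrite mulKg.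
Qed.

(** Write x - r x as r x (n - 1), with n in N such that x = (r x) n. *)
Lemma lker_coset_rep_sum (N : {group G}) u :
  u \in lker (collapse b (coset_rep N)) ->
  exists a : G -> A, u = \sum_(n in N) a n * (b n - 1).
Proof.
rewrite memv_ker => /eqP ru0.
pose r := coset_rep N; pose q x := ((r x)^-1 * x)%g.
have Nq x : q x \in N by apply/coset_repP/coset_repK.
exists (fun n => \sum_(x | q x == n) gcoef b x u *: b (r x)).
transitivity (u - collapse b r u); first by rewrite ru0 subr0.
rewrite {1 2}(gcoef_sum bG u) linear_sum /= -sumrB (partition_big q [in N]) //=.
apply: eq_bigr => n Nn; rewrite mulr_suml; apply: eq_bigr => x /eqP <-.
rewrite linearZ /= (collapseE bG) -scalerBr -scalerAl mulrBr mulr1 -bM /q.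
by rewrite mulKVg.
Qed.

End Local.

(** * Cyclic commutator subgroups and principal left ideals *)

Section Principal.
Variables (F : fieldType) (A : falgType F) (p : nat).
Hypothesis charF : p \in [pchar F].
Variables (G : finGroupType) (b : G -> A).
Hypothesis bG : group_basis b.
Hypothesis pG : p.-group [set: G].

Definition principal_left (W : {vspace A}) :=
  exists y : A, forall u, u \in W <-> exists a, u = a * y.

Lemma principal_of_cyclic_der1 :
  cyclic [set: G]^`(1)%g -> principal_left (lker (collapse b (der1_rep G))).
Proof.
case/cyclicP=> z defD; exists (b z - 1) => u; split=> [|[a ->]]; last first.
  by apply: lker_coset_rep_mem; rewrite // /= defD cycle_id.
case/(lker_coset_rep_sum bG)=> a ->; elim/big_rec: _ => [|n v].
  by exists 0; rewrite mul0r.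
rewrite /= defD => /cycleP[i ->] [d ->].
have [e ->] : exists e, b (z ^+ i)%g - 1 = e * (b z - 1).
  elim: i => [|i [e IHi]].
    by exists 0; rewrite (group_basis1 bG) subrr mul0r.
  exists (b (z ^+ i)%g + e).
  rewrite mulrDl -IHi mulrBr mulr1 -(group_basisM bG).
  by rewrite -expgSr addrA subrK.
by exists (a (z ^+ i)%g * e + d); rewrite mulrDl mulrA.
Qed.

(** Let y generate the left ideal J.  Then y is a combination of the n - 1 with
    n in G', and n - 1 = r_n y.  Not all r_n have augmentation 0, unless y = 0:
    otherwise (1 - s) y = 0 for some s of augmentation 0, with 1 - s invertible.
    If r_n is invertible, J is also generated by n - 1, so that m - 1 is, for m
    in G', killed by the projection to the cosets of <[n]>, whence m is in
    <[n]>. *)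
Lemma cyclic_der1_of_principal :
  principal_left (lker (collapse b (der1_rep G))) -> cyclic [set: G]^`(1)%g.
Proof.
set D := [set: G]^`(1)%G; case=> y yP.
have b1 := group_basis1 bG.
have : y \in lker (collapse b (coset_rep D)).
  by apply/yP; exists 1; rewrite mul1r.
case/(lker_coset_rep_sum bG)=> a ya.
have /fin_all_exists[r rP] : forall n, exists r, n \in D -> b n - 1 = r * y.
  move=> n; case: (boolP (n \in D)) => [Dn | _]; last by exists 0.
  have /yP[r ->] : b n - 1 \in lker (collapse b (coset_rep D)).
    by rewrite -[b n - 1]mul1r lker_coset_rep_mem.
  by exists r.
have [/exists_inP[n Dn nzr] | aug0] := boolP [exists n in D, aug b (r n) != 0].
  apply/cyclicP; exists n; apply/eqP; rewrite eqEsubset cycle_subG Dn andbT.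
  apply/subsetP=> m Dm.
  have : b m - 1 \in lker (collapse b (coset_rep <[n]>%G)).
    rewrite rP // -[y](mulKr (aug_unit charF bG pG nzr)) -rP // mulrA.
    by apply: lker_coset_rep_mem; rewrite // cycle_id.
  rewrite memv_ker linearB /= -b1 !(collapseE bG) subr_eq0 => /eqP.
  by move/(basis_inj bG)/esym/coset_repP; rewrite invg1 mul1g.
rewrite negb_exists_in in aug0; have {}aug0 n : n \in D -> aug b (r n) = 0.
  by move/(forall_inP aug0)/negPn/eqP.
have y0 : y = 0.
  pose s := 1 - \sum_(n in D) a n * r n.
  have augs : aug b s = 1.
    rewrite linearB /= (aug1 bG) linear_sum /= big1 ?subr0 // => n Dn.
    by rewrite (augM bG) aug0 // mulr0.
  have Us : s \is a GRing.unit.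
    by apply: (aug_unit charF bG pG); rewrite augs oner_neq0.
  apply: (mulrI Us); rewrite mulr0 mulrBl mul1r mulr_suml {1}ya -sumrB.
  by apply: big1 => n Dn; rewrite -mulrA -rP // subrr.
suff -> : [set: G]^`(1)%g = 1%g by apply: cyclic1.
apply/trivgP/subsetP=> n Dn; have := rP n Dn.
rewrite y0 mulr0 => /eqP; rewrite subr_eq0 -b1 => /eqP/(basis_inj bG)->.
exact: set11.
Qed.

End Principal.

Section CyclicInvariant.
Variables (F : fieldType) (A : falgType F) (p : nat).
Hypothesis charF : p \in [pchar F].
Variables (G H : finGroupType) (b : G -> A) (c : H -> A).
Hypotheses (bG : group_basis b) (cH : group_basis c).
Hypotheses (pG : p.-group [set: G]) (pH : p.-group [set: H]).

Lemma aug_eq : aug b = aug c.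
Proof. apply: (aug_unique charF cH pH); [exact: aug1 | exact: augM]. Qed.

Lemma cyclic_der1_eq : cyclic [set: G]^`(1)%g -> cyclic [set: H]^`(1)%g.
Proof.
move/(principal_of_cyclic_der1 bG); rewrite (lker_der1_rep_eq bG cH).
exact: (cyclic_der1_of_principal charF cH pH).
Qed.

End CyclicInvariant.

(** * Exponent p *)

Section Trace.
Variables (F : fieldType) (A : falgType F) (p : nat).
Hypothesis charF : p \in [pchar F].
Variables (G : finGroupType) (b : G -> A).
Hypothesis bG : group_basis b.

(** Expand u ^ p into words of length p.  Rotating a word does not change its
    value under a trace form, so only the constant words contribute. *)
Lemma trace_pow (phi : 'Hom(A, F^o)) u : trace_form phi ->
  phi (u ^+ p) = \sum_x gcoef b x u ^+ p * phi (b (x ^+ p)%g).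
Proof.
move=> tr; have p_pr := pcharf_prime charF.
pose t x := gcoef b x u *: b x.
have -> : u ^+ p = \sum_(f : {ffun 'I_p -> G}) \prod_i t (f i).
  by rewrite -(bigA_distr_bigA (fun=> t)) prodr_const card_ord -(gcoef_sum bG).
rewrite linear_sum (@sum_rotation F) //=.
- apply: eq_bigr => x _; rewrite (eq_bigr (fun=> t x)) => [|i _]; last first.
    by rewrite ffunE.
  by rewrite prodr_const card_ord exprZn linearZ /= (basisX bG).
- by move=> v; rewrite -mulr_natr (pcharf0 charF) mulr0.
move=> f; case: p f p_pr => // n f _.
rewrite big_ord_recr [in RHS]big_ord_recl /= tr; congr (phi (t _ * _)).
  by rewrite ffunE; congr (f _); apply: val_inj; rewrite /= modnn.
apply: eq_bigr => i _; rewrite ffunE; congr (t (f _)); apply: val_inj.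
by rewrite /= modn_small // ltnS.
Qed.

End Trace.

Section ExponentInvariant.
Variables (F : fieldType) (A : falgType F) (p : nat).
Hypothesis charF : p \in [pchar F].
Variables (G H : finGroupType) (b : G -> A) (c : H -> A).
Hypotheses (bG : group_basis b) (cH : group_basis c).
Hypotheses (pG : p.-group [set: G]) (pH : p.-group [set: H]).

(** In exponent p, trace_pow makes phi (u ^ p) equal to aug u ^ p times phi 1.
    Apply this to u = x - 1 with x in H: then x ^ p - 1 is killed by all trace
    forms, so x ^ p is conjugate to 1. *)
Lemma exponent_p_eq :
  (forall x : G, x ^+ p = 1)%g -> (forall x : H, x ^+ p = 1)%g.
Proof.
move=> G1 x.
have aug0 : aug b (c x - 1) = 0.
  rewrite (aug_eq charF bG cH pH) linearB /= (aug1 cH) (aug_basis cH) subrr //.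
have : (c x - 1) ^+ p \in lker (collapse c class_rep).
  apply/(lker_class_repP cH) => phi tr.
  rewrite (trace_pow charF bG) //.
  rewrite (eq_bigr (fun y => gcoef b y (c x - 1) ^+ p * phi 1)) => [|y _];
    last by rewrite G1 (group_basis1 bG).
  have -> : forall v : A,
      \sum_y gcoef b y v ^+ p * phi 1 = aug b v ^+ p * phi 1.
    move=> v; rewrite {2}(gcoef_sum bG v) linear_sum -mulr_suml; congr (_ * _).
    rewrite -(pFrobenius_autE charF) rmorph_sum; apply: eq_bigr => y _.
    by rewrite linearZ /= (aug_basis bG) pFrobenius_autE [_ *: _]mulr1.
  by rewrite aug0 expr0n gtn_eqF ?mul0r ?prime_gt0 ?(pcharf_prime charF).
have := basis_sub1Xp charF cH x 1; rewrite expn1 => ->.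
rewrite -(group_basis1 cH) memv_ker linearB /= !(collapseE cH) subr_eq0 => /eqP.
case/(basis_inj cH)/esym/class_repP/imsetP=> y _ ->.
by rewrite conj1g.
Qed.

End ExponentInvariant.

(** * Powers of the augmentation ideal in exponent p *)

Section Filtration.
Variables (F : fieldType) (A : falgType F) (p : nat).
Hypothesis charF : p \in [pchar F].
Variables (G : finGroupType) (b : G -> A).
Hypothesis bG : group_basis b.
Hypothesis pG : p.-group [set: G].
Let b1 := group_basis1 bG.
Let bM := group_basisM bG.
Implicit Types (u v w : A) (N K : {group G}).
Local Notation L n := ('L_n([set: G])%g).

(** The weight n part of the filtration of FN generated by giving y - 1 the
    weight m for y in N and in the m-th lower central term of G.  For N = G it
    contains D ^ n, D the augmentation ideal; the filtrations of smaller N serve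
    an induction on N. *)
Inductive filt N : nat -> A -> Prop :=
| filt_one : filt N 0 1
| filt_mul m n y u of y \in N & y \in L m & filt N n u :
    filt N (m + n) ((b y - 1) * u)
| filt_lin n a u v of filt N n u & filt N n v : filt N n (a *: u + v)
| filt_le m n u of (n <= m)%N & filt N m u : filt N n u.

Lemma filt0 N n : filt N n 0.
Proof.
rewrite -(mul0r (1 : A)) -(subrr 1) -{1}b1 -[n]addn0.
by apply: filt_mul; rewrite ?group1 //; apply: filt_one.
Qed.

Lemma filtZ N n a u : filt N n u -> filt N n (a *: u).
Proof. by move=> fu; rewrite -[_ *: _]addr0; apply: filt_lin (filt0 _ _). Qed.

Lemma filtD N n u v : filt N n u -> filt N n v -> filt N n (u + v).
Proof. by move=> fu fv; rewrite -[u]scale1r; apply: filt_lin. Qed.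

Lemma aug_filt N n u : filt N n u -> (0 < n)%N -> aug b u = 0.
Proof.
elim=> {n u} [//|m n y u _ _ _ _ _|n a u v _ IHu _ IHv n0|m n u lenm _ IHu n0].
- by rewrite (augM bG) linearB /= (aug_basis bG) (aug1 bG) subrr mul0r.
- by rewrite linearP /= IHu // IHv // scaler0 addr0.
by apply: IHu; apply: leq_trans lenm.
Qed.

Lemma filt_span N n u : filt N n u -> u \in <<[seq b x | x in N]>>%VS.
Proof.
have bN y : y \in N -> b y \in <<[seq b x | x in N]>>%VS.
  by move=> Ny; rewrite memv_span // image_f.
elim=> {n u} [|m n y u Ny _ _ IHu|n a u v _ IHu _ IHv|m n u _ _ //].
- by rewrite -b1 bN.
- rewrite mulrBl mul1r memvB //.
  have -> : b y * u = amull (b y) u by rewrite lfunE.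
  apply: (subvP _ _ (memv_img (amull (b y)) IHu)); rewrite limg_span.
  apply/span_subvP=> _ /mapP[_ /imageP[x Nx ->] ->].
  by rewrite lfunE /= -bM bN // groupM.
by rewrite memvD ?memvZ.
Qed.

Definition conj_by x u := b x * u * b x^-1%g.

(** For x of weight w, conjugation by x is the identity up to terms of weight
    higher by w: it is multiplicative, and it changes y of weight m by a
    factor that is a commutator of weight m + w. *)
Lemma filt_conj N n x (w : nat) u :
  N <| [set: G]%g -> x \in L w -> filt N n u ->
  filt N n (conj_by x u) /\ filt N (n + w) (conj_by x u - u).
Proof.
move=> nN Lx; have NJ y : y \in N -> (y ^ x^-1)%g \in N.
  by move=> Ny; rewrite memJ_norm // (subsetP (normal_norm nN)) ?inE.
have cM v1 v2 : conj_by x (v1 * v2) = conj_by x v1 * conj_by x v2.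
  rewrite /conj_by -!mulrA; congr (_ * (_ * _)).
  by rewrite [RHS]mulrA -bM mulVg b1 mul1r.
have c1 : conj_by x 1 = 1 by rewrite /conj_by mulr1 -bM mulgV b1.
have cb y : conj_by x (b y) = b (y ^ x^-1)%g.
  by rewrite /conj_by -!bM conjgE invgK -mulgA.
have cB v1 v2 : conj_by x (v1 - v2) = conj_by x v1 - conj_by x v2.
  by rewrite /conj_by mulrBr mulrBl.
elim=> {n u} [|m n y u Ny Ly fu [IH1 IH2]|n a u v _ [IHu1 IHu2] _ [IHv1 IHv2]|
  m n u le _ [IH1 IH2]].
- by rewrite c1 subrr; split; [apply: filt_one | apply: filt0].
- set y' := (y ^ x^-1)%g; have Ly' : y' \in L m.
    by rewrite memJ_norm // (subsetP (lcn_norm m _)) ?inE.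
  have cm : conj_by x ((b y - 1) * u) = (b y' - 1) * conj_by x u.
    by rewrite cM cB cb c1.
  rewrite cm; split; first by apply: filt_mul; rewrite // NJ.
  pose d := (y' * y^-1)%g; have Nd : d \in N by rewrite groupM ?NJ ?groupV.
  have Ld : d \in L (m + w)%N.
    have -> : d = [~ x^-1, y^-1]%g.
      by rewrite /d /y' /commg !conjgE !invgK !mulgA.
    rewrite addnC; apply: (subsetP (lcn_comm _ w m)).
    by rewrite mem_commg ?groupV.
  have -> : (b y' - 1) * conj_by x u - (b y - 1) * u =
     (b y' - 1) * (conj_by x u - u) +
     ((b d - 1) * ((b y - 1) * u) + (b d - 1) * u).
    have -> : (b d - 1) * ((b y - 1) * u) + (b d - 1) * u = (b y' - b y) * u.
      rewrite -mulrDr -{2}[u]mul1r -mulrDl subrK mulrA mulrBl mul1r -bM.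
      by rewrite /d mulgKV.
    have -> : b y' - b y = (b y' - 1) - (b y - 1) by rewrite opprB addrA subrK.
    move: (b y' - 1) (b y - 1) (conj_by x u) => X Y U.
    by rewrite mulrBr mulrBl addrA subrK.
  apply: filtD; first by rewrite -addnA; apply: filt_mul => //; apply: NJ.
  apply: filtD.
    apply: (@filt_le _ (m + w + (m + n))); first by clear; lia.
    by apply: filt_mul => //; apply: filt_mul.
  have -> : (m + n + w = m + w + n)%N by rewrite addnAC.
  exact: filt_mul.
- have cl : conj_by x (a *: u + v) = a *: conj_by x u + conj_by x v.
    by rewrite /conj_by mulrDr mulrDl -scalerAr -scalerAl.
  rewrite cl; split; first exact: filt_lin.
  by rewrite opprD addrACA -scalerBr; apply: filt_lin.
split; first exact: filt_le le _.
by apply: filt_le IH2; rewrite leq_add2r.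
Qed.

Section Split.
Variables (N K : {group G}) (w : nat) (x : G).
Hypotheses (nN : N <| [set: G]%g) (w_gt0 : (0 < w)%N) (Lx : x \in L w).
Hypothesis xp : (x ^+ p = 1)%g.
Hypotheses (defK : (N * <[x]> = K)%g) (sKN : K :&: L w.+1 \subset N).

(** Here K = N <x> with x of weight w, and elements of FK are written as
    polynomials of degree below p in x - 1 with coefficients in FN on the left.
    The subtraction n - j * w is truncated: a large power of x - 1 leaves no
    condition on its coefficient. *)
Definition split_filt n u := exists e : nat -> A,
  (forall j, filt N (n - j * w) (e j)) /\ u = \sum_(j < p) e j * (b x - 1) ^+ j.

Lemma split_filt_lin n a u v :
  split_filt n u -> split_filt n v -> split_filt n (a *: u + v).
Proof.
move=> [e [fe ->]] [d [fd ->]]; exists (fun j => a *: e j + d j).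
split=> [j|]; first exact: filt_lin.
rewrite scaler_sumr -big_split; apply: eq_bigr => j _ /=.
by rewrite mulrDl scalerAl.
Qed.

Lemma split_filt_le m n u : (n <= m)%N -> split_filt m u -> split_filt n u.
Proof.
move=> le_nm [e [fe ->]]; exists e; split=> // j.
by apply: filt_le (fe j); rewrite leq_sub2r.
Qed.

Definition raises m y :=
  forall n u, split_filt n u -> split_filt (m + n) ((b y - 1) * u).

Lemma raises_N m y : y \in N -> y \in L m -> raises m y.
Proof.
move=> Ny Ly n u [e [fe ->]]; exists (fun j => (b y - 1) * e j); split=> [j|].
  apply: (@filt_le _ (m + (n - j * w))); first by clear; lia.
  exact: filt_mul.
by rewrite mulr_sumr; apply: eq_bigr => j _; rewrite mulrA.
Qed.

(** Moving x - 1 through a coefficient e replaces e by its conjugate and adds an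
    error of weight higher by w (filt_conj); the overflow at degree p vanishes
    because (x - 1) ^ p = x ^ p - 1 = 0. *)
Lemma raises_x : raises w x.
Proof.
move=> n u [e [fe ->]].
pose e' j := conj_by x (e j).
exists (fun j => (if j is i.+1 then e' i else 0) + (e' j - e j)); split=> [j|].
  apply: filtD; last first.
    apply: (@filt_le _ (n - j * w + w)); first by clear; lia.
    by have [] := filt_conj nN Lx (fe j).
  case: j => [|j]; first exact: filt0.
  have [fj _] := filt_conj nN Lx (fe j).
  by apply: filt_le fj; rewrite mulSn; clear; lia.
have xe j : (b x - 1) * e j = e' j * (b x - 1) + (e' j - e j).
  rewrite /e' /conj_by mulrBr -!mulrA -bM mulVg b1 !mulr1 mulrBl mul1r.
  by rewrite addrA subrK.
have xpow : (b x - 1) ^+ p = 0.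
  by have := basis_sub1Xp charF bG x 1; rewrite expn1 xp b1 subrr.
rewrite mulr_sumr (eq_bigr (fun j : 'I_p => e' j * (b x - 1) ^+ j.+1 +
   (e' j - e j) * (b x - 1) ^+ j)) => [|j _]; last first.
  by rewrite mulrA xe mulrDl -mulrA -exprS.
rewrite [RHS](eq_bigr (fun j : 'I_p =>
   (if j : nat is i.+1 then e' i else 0) * (b x - 1) ^+ j +
   (e' j - e j) * (b x - 1) ^+ j)) => [|j _]; last by rewrite mulrDl.
rewrite !big_split /=; congr (_ + _).
case: p (prime_gt0 (pcharf_prime charF)) xpow => // q _ xpow.
rewrite big_ord_recr [RHS]big_ord_recl /= xpow mulr0 addr0 mul0r add0r.
by [].
Qed.

Lemma raisesM m y z : raises m y -> raises m z -> raises m (y * z)%g.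
Proof.
move=> ry rz n u fu.
have -> : (b (y * z)%g - 1) * u = 1 *: ((b y - 1) * ((b z - 1) * u)) +
    (1 *: ((b y - 1) * u) + (b z - 1) * u).
  rewrite bM !scale1r mulrA -!mulrDl; congr (_ * _).
  by rewrite mulrBr mulr1 addrA subrK mulrBl mul1r addrA subrK.
apply: split_filt_lin.
  by apply: (@split_filt_le (m + (m + n))); [rewrite leq_addl | apply/ry/rz].
by apply: split_filt_lin; [apply: ry | apply: rz].
Qed.

(** Above weight w all elements of K lie in N.  Up to weight w, x has the
    required weight itself, and K is N times the powers of x. *)
Lemma raises_K m y : y \in K -> y \in L m -> raises m y.
Proof.
move=> Ky Ly; have [lt_wm | le_mw] := ltnP w m.
  apply: raises_N => //; apply: (subsetP sKN); rewrite inE Ky.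
  exact: (subsetP (lcn_sub_leq _ lt_wm)).
have Lmx : x \in L m by apply: (subsetP (lcn_sub_leq _ le_mw)).
have r1 : raises m 1%g by apply: raises_N; rewrite ?group1.
have rx : raises m x.
  by move=> n u /raises_x fu; apply: split_filt_le fu; rewrite leq_add2r.
move: Ky; rewrite -defK => /mulsgP[y0 _ Ny0 /cycleP[i ->] ey].
rewrite ey; apply: raisesM.
  by apply: raises_N; rewrite // -(groupMr _ (groupX i Lmx)) -ey.
by elim: i {ey} => [|i IHi] //; rewrite expgS; apply: raisesM.
Qed.

Lemma filt_split n u : filt K n u -> split_filt n u.
Proof.
elim=> {n u} [|m n y u Ky Ly _ IHu|n a u v _ IHu _ IHv|m n u le _ IHu].
- exists (fun j => (j == 0%N)%:R); split=> [j|].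
    case: j => [|j]; first exact: filt_one.
    exact: filt0.
  case: p (prime_gt0 (pcharf_prime charF)) => // q _.
  rewrite big_ord_recl /= mulr1 big1 ?addr0 // => j _.
  by rewrite /= mul0r.
- exact: raises_K.
- exact: split_filt_lin.
exact: split_filt_le le IHu.
Qed.

End Split.

(** Elements of N lie in different cosets of K. *)
Lemma collapse_span_inj N K u : N :&: K = 1%g ->
  u \in <<[seq b x | x in N]>>%VS -> collapse b (coset_rep K) u = 0 -> u = 0.
Proof.
move=> tiNK Nu ru0; apply/eqP; rewrite -memv0.
have <- : (<<[seq b x | x in N]>> :&: lker (collapse b (coset_rep K)) = 0)%VS.
  have := limg_ker_dim (collapse b (coset_rep K)) <<[seq b x | x in N]>>%VS.
  rewrite (dim_collapse bG) card_coset_rep -indexgI tiNK indexg1.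
  rewrite (dim_span_basis bG) => e; apply/eqP.
  by rewrite -dimv_eq0 -(eqn_add2r #|N|) e.
by rewrite memv_cap Nu memv_ker ru0 eqxx.
Qed.

(** The inclusion of dimension subgroups in the lower central series, stated for
    subgroups N so that it can be proved by climbing from the trivial group to
    G. *)
Definition dim_sub_lcn N :=
  forall n z, z \in N -> filt N n (b z - 1) -> z \in L n.

(** Expand z - 1 as in split_filt; projecting to the cosets of <[x]> keeps the
    constant coefficient only.  If z is in N, then z - 1 is this coefficient,
    and N is under control.  If z is not in N, take x = z: the constant
    coefficient is 0, and if n > w the linear one has augmentation 0, so that
    z - 1 = s (z - 1) with s of augmentation 0, and z = 1 as 1 - s is
    invertible. *)
Lemma dim_sub_lcn_step N K (w : nat) : (forall x : G, x ^+ p = 1)%g ->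
  N <| [set: G]%g -> (0 < w)%N -> maximal N K ->
  K \subset L w -> L w.+1 \subset N ->
  dim_sub_lcn N -> dim_sub_lcn K.
Proof.
move=> G1 nN w_gt0 maxN sKL sLN dN n z Kz fz.
have p_pr := pcharf_prime charF.
have nNK : N <| K.
  by rewrite (normalS _ _ nN) ?subsetT // (proper_sub (maxgroupp maxN)).
have tiNx x : x \notin N -> N :&: <[x]>%G = 1%g.
  move=> nNx; rewrite setIC; apply: prime_TIg; rewrite ?cycle_subG // -orderE.
  rewrite (@nt_prime_order _ p) //; by apply: contraNneq nNx => ->.
have defK x : x \in K -> x \notin N -> (N * <[x]> = K)%g.
  by move=> Kx nNx; apply: mulg_normal_maximal; rewrite ?cycle_subG.
have splitx x : x \in K -> x \notin N -> split_filt N w x n (b z - 1).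
  move=> Kx nNx; apply: (@filt_split N K w x) => //; first exact: (subsetP sKL).
    exact: defK.
  by rewrite (subset_trans (subsetIr _ _)).
have head x (e : nat -> A) :
  collapse b (coset_rep <[x]>) (\sum_(j < p) e j * (b x - 1) ^+ j) =
  collapse b (coset_rep <[x]>) (e 0%N).
  case: p p_pr => // q _; rewrite big_ord_recl mulr1 linearD linear_sum /=.
  rewrite big1 ?addr0 // => j _; rewrite exprSr mulrA; apply/eqP.
  by rewrite -memv_ker; apply: lker_coset_rep_mem; rewrite // cycle_id.
have [Nz | nNz] := boolP (z \in N).
  have /properP[_ [x Kx nNx]] := maxgroupp maxN.
  have [e [fe ez]] := splitx x Kx nNx.
  have e0 : b z - 1 = e 0%N.
    apply/eqP; rewrite -subr_eq0; apply/eqP.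
    apply: (@collapse_span_inj N <[x]>%G) => //; first exact: tiNx.
      rewrite memvB ?(filt_span (fe 0%N)) // memvB // -?b1 memv_span //;
        by rewrite image_f.
    by rewrite linearB /= {1}ez head subrr.
  by apply: dN => //; rewrite e0; have := fe 0%N; rewrite mul0n subn0.
have [le_nw | lt_wn] := leqP n w.
  exact: (subsetP (lcn_sub_leq _ le_nw)) _ (subsetP sKL _ Kz).
have [e [fe ez]] := splitx z Kz nNz.
have e0 : e 0%N = 0.
  apply: (@collapse_span_inj N <[z]>%G) => //; first exact: tiNx.
    exact: filt_span (fe 0%N).
  rewrite -head -ez -[b z - 1]mul1r; apply/eqP; rewrite -memv_ker.
  by apply: lker_coset_rep_mem; rewrite // cycle_id.
have e1 : aug b (e 1%N) = 0.
  by apply: (aug_filt (fe 1%N)); rewrite mul1n subn_gt0.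
have [q ep] : exists q, p = q.+2.
  by case: p (prime_gt1 p_pr) => [|[|q]] // _; exists q.
move: ez; rewrite ep !big_ord_recl /= e0 mul0r add0r /bump /= !add1n expr1.
move=> ez.
pose r := 1 - (e 1%N + \sum_(i < q) e i.+2 * (b z - 1) ^+ i.+1).
have augr : aug b r = 1.
  rewrite linearB linearD /= (aug1 bG) e1 add0r linear_sum /=.
  rewrite big1 ?subr0 // => i _.
  rewrite (augM bG) exprS (augM bG) linearB /= (aug_basis bG) (aug1 bG) subrr.
  by rewrite mul0r mulr0.
have Ur : r \is a GRing.unit.
  by apply: (aug_unit charF bG pG); rewrite augr oner_neq0.
have : b z - 1 = 0.
  apply: (mulrI Ur); rewrite mulr0 mulrBl mul1r mulrDl {1}ez mulr_suml.
  apply/eqP; rewrite subr_eq0; apply/eqP; congr (_ + _).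
  by apply: eq_bigr => i _; rewrite -mulrA -exprSr.
move/eqP; rewrite subr_eq0 -b1 => /eqP/(basis_inj bG) z1.
by rewrite z1 group1 in nNz.
Qed.

(** Refine the lower central series by subgroups of index p; they are normal in
    G since the factors of the series are central. *)
Lemma dim_sub_lcn_refine K (w : nat) :
  (forall x : G, x ^+ p = 1)%g -> (0 < w)%N ->
  K \subset L w -> L w.+1 \subset K -> dim_sub_lcn K.
Proof.
move=> G1; have [n] := ubnP #|K|.
elim: n K w => // n IHn K w leKn w_gt0 sKL sLK.
have nilG := pgroup_nil pG.
have [K1 | ntK] := eqsVneq K 1%g.
  by move=> m z; rewrite K1 => /set1P-> _; apply: group1.
(* when K is itself a term of the series, count it from the next factor on *)
have [v [v_gt0 sKLv prLv]] : exists v : nat,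
    [/\ (0 < v)%N, K \subset L v & L v.+1 \proper K].
  have [eqK | neqK] := eqVneq (L w.+1) K; last first.
    by exists w; split; rewrite // properEneq neqK.
  exists w.+1; split=> //; rewrite -eqK // lcnSn.
  apply: (nil_comm_properl nilG); first exact: subsetT.
    by move: ntK; rewrite -eqK.
  by rewrite subsetI subsetT; apply: lcn_norm.
have [M_K | [N maxN sLN]] := maximal_exists (proper_sub prLv).
  by rewrite M_K properxx in prLv.
have sNK := proper_sub (maxgroupp maxN).
have nN : N <| [set: G]%g.
  rewrite /normal subsetT -commg_subr commGC.
  apply: subset_trans sLN.
  rewrite (subset_trans (commSg _ (subset_trans sNK sKLv))) //.
  exact: lcnSnS.
apply: (dim_sub_lcn_step G1 nN v_gt0 maxN sKLv sLN).
apply: (IHn N v) => //; last exact: subset_trans sKLv.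
by rewrite (leq_trans (proper_card (maxgroupp maxN))).
Qed.

Lemma filt_expv n u : u \in (lker (aug b) ^+ n)%VS -> filt [set: G]%G n u.
Proof.
elim: n u => [|n IHn] u.
  rewrite expv0 => /vlineP[a ->]; apply: filtZ; exact: filt_one.
rewrite expvSl; move: u; apply: prodv_ind => [|a u v|u v].
- exact: filt0.
- exact: filt_lin.
rewrite memv_ker => /eqP augu /IHn fv.
rewrite (aug0_sum bG augu).
rewrite mulr_suml; elim/big_rec: _ => [|x w _ fw]; first exact: filt0.
rewrite -scalerAl; apply: filt_lin => //.
by rewrite -add1n; apply: filt_mul; rewrite ?inE // lcn1 inE.
Qed.

Lemma lcn_of_aug_power n x : (forall x : G, x ^+ p = 1)%g ->
  b x - 1 \in (lker (aug b) ^+ n)%VS -> x \in L n.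
Proof.
move=> G1 /filt_expv; apply: (@dim_sub_lcn_refine _ 1%N) => //.
exact: lcn_sub.
Qed.

End Filtration.

(** * Lie layers of the augmentation ideal *)

Lemma comm_sub1 (R : pzRingType) (u v : R) :
  (u - 1) * (v - 1) - (v - 1) * (u - 1) = u * v - v * u.
Proof.
have e (x y : R) : (x - 1) * y - y * (x - 1) = x * y - y * x.
  by rewrite mulrBl mulrBr mul1r mulr1 opprB addrA subrK.
by rewrite e -opprB e opprB.
Qed.

Section Commutators.
Variables (F : fieldType) (A : falgType F) (p : nat).
Variables (G : finGroupType) (b : G -> A).
Hypothesis bG : group_basis b.
Let b1 := group_basis1 bG.
Let bM := group_basisM bG.
Implicit Types (u v w : A).
Local Notation L n := ('L_n([set: G])%g).
Local Notation D := (lker (aug b)).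

Lemma aug_ideal_basis x : b x - 1 \in D.
Proof. by rewrite memv_ker linearB /= (aug_basis bG) (aug1 bG) subrr. Qed.

Lemma aug_idealE : D = <<[seq b x - 1 | x : G]>>%VS.
Proof.
apply/eqP; rewrite eqEsubv; apply/andP; split; last first.
  by apply/span_subvP=> _ /imageP[x _ ->]; apply: aug_ideal_basis.
apply/subvP=> u; rewrite memv_ker => /eqP augu.
rewrite (aug0_sum bG augu).
by apply: memv_suml => x _; rewrite memvZ // memv_span // image_f.
Qed.

Lemma aug_ideal_mull n a u : u \in (D ^+ n.+1)%VS -> a * u \in (D ^+ n.+1)%VS.
Proof.
rewrite expvSl; move: u; apply: prodv_ind => [|d u v IHu IHv|u v Du Dv].
- by rewrite mulr0 mem0v.
- by rewrite mulrDr -scalerAr memvD ?memvZ.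
rewrite mulrA memv_mul // memv_ker (augM bG).
by move: Du; rewrite memv_ker => /eqP->; rewrite mulr0.
Qed.

Lemma basis_commE x y :
  b [~ x, y]%g - 1 =
  b (y * x)^-1%g * ((b x - 1) * (b y - 1) - (b y - 1) * (b x - 1)).
Proof.
rewrite comm_sub1 mulrBr -!bM mulVg b1; congr (b _ - _).
by rewrite /commg conjgE invMg !mulgA.
Qed.

(** Up to higher order, group commutators are Lie commutators. *)
Lemma basis_comm_sub1E x y :
  (b x - 1) * (b y - 1) - (b y - 1) * (b x - 1) =
  (b [~ x, y]%g - 1) + (b (y * x)%g - 1) * (b [~ x, y]%g - 1).
Proof.
have -> : (b x - 1) * (b y - 1) - (b y - 1) * (b x - 1) =
    b (y * x)%g * (b [~ x, y]%g - 1).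
  by rewrite basis_commE mulrA -bM mulgV b1 mul1r.
by rewrite [in RHS]mulrDl mulN1r [RHS]addrC subrK.
Qed.

Lemma aug_power_of_lcn k x : x \in L k.+1 -> b x - 1 \in (D ^+ k.+1)%VS.
Proof.
elim: k x => [|k IHk] x; first by move=> _; rewrite expv1 aug_ideal_basis.
move: x; apply: lcnS_ind => [|x y _ IHx IHy|x y Lx].
- by rewrite b1 subrr mem0v.
- have -> : b (x * y)%g - 1 = b x * (b y - 1) + (b x - 1).
    by rewrite mulrBr mulr1 -bM addrA subrK.
  by rewrite memvD // aug_ideal_mull.
rewrite basis_commE aug_ideal_mull // memvB //.
  by rewrite expvSr memv_mul ?IHk ?aug_ideal_basis.
by rewrite expvSl memv_mul ?IHk ?aug_ideal_basis.
Qed.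

(** The notation L k.+1 counts the series from L 1 = G, so the elements x - 1
    belong to D ^ (k + 1) and the layer records them modulo D ^ (k + 2). *)
Definition lcn_layer k : {vspace A} :=
  (<<[seq (b x - 1)%R | x in L k.+1]>> + D ^+ k.+2)%VS.

Lemma lcn_layer_mem k x : x \in L k.+1 -> b x - 1 \in lcn_layer k.
Proof.
move=> Lx; apply: subvP (addvSl _ _) _ _; apply: memv_span; exact: image_f.
Qed.

Lemma lcn_layer_comm k u v : u \in lcn_layer k -> v \in D ->
  u * v - v * u \in lcn_layer k.+1.
Proof.
case/memv_addP=> u1 Lu [u2 Du ->] Dv.
rewrite mulrDl mulrDr opprD addrACA memvD //; last first.
  apply: subvP (addvSr _ _) _ _; apply: memvB.
    by rewrite expvSr memv_mul.
  by rewrite expvSl memv_mul.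
have linl a z w X : (a *: z + w) * X - X * (a *: z + w) =
    a *: (z * X - X * z) + (w * X - X * w).
  by rewrite mulrDl mulrDr -scalerAl -scalerAr opprD addrACA -scalerBr.
move: u1 Lu; apply: span_ind => [|a z w IHz IHw|_ /imageP[x Lx ->]].
- by rewrite mul0r mulr0 subrr mem0v.
- by rewrite linl memvD ?memvZ.
rewrite -opprB memvN; move: v Dv; rewrite aug_idealE.
apply: span_ind => [|a z w IHz IHw|_ /imageP[y _ ->]].
- by rewrite mul0r mulr0 subrr mem0v.
- by rewrite linl memvD ?memvZ.
rewrite -memvN opprB.
have LR : [~ x, y]%g \in L k.+2 by rewrite lcnSn mem_commg ?inE.
rewrite basis_comm_sub1E.
rewrite memvD ?lcn_layer_mem //; apply: subvP (addvSr _ _) _ _.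
by rewrite expvSl memv_mul ?aug_ideal_basis ?aug_power_of_lcn.
Qed.

End Commutators.

Section LieLayers.
Variables (F : fieldType) (A : falgType F) (p : nat).
Hypothesis charF : p \in [pchar F].
Variables (G H : finGroupType) (b : G -> A) (c : H -> A).
Hypotheses (bG : group_basis b) (cH : group_basis c).
Hypotheses (pG : p.-group [set: G]) (pH : p.-group [set: H]).

(** Layer k + 1 consists of the Lie commutators of layer k with D, modulo
    D ^ (k + 3), and D is the same for both bases; so the inclusion propagates
    from k to k + 1. *)
Lemma lcn_layer_sub k : (lcn_layer b k <= lcn_layer c k)%VS.
Proof.
have eqD := aug_eq charF bG cH pH.
have sDc n : (lker (aug b) ^+ n.+2 <= lcn_layer c n)%VS by rewrite eqD addvSr.
suff sub x : x \in 'L_k.+1([set: G])%g -> b x - 1 \in lcn_layer c k.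
  rewrite subv_add sDc andbT; apply/span_subvP=> _ /imageP[x Lx ->].
  exact: sub.
elim: k x => [|k IHk] x.
  move=> _; have := aug_ideal_basis bG x; rewrite eqD (aug_idealE cH).
  apply: subvP => //; apply: subv_trans (addvSl _ _).
  apply/span_subvP=> _ /imageP[y _ ->].
  by rewrite memv_span // image_f ?lcn1 ?inE.
move: x; apply: lcnS_ind => [|x y Lx IHx IHy|x y Lx /=].
- by rewrite (group_basis1 bG) subrr mem0v.
- have -> : b (x * y)%g - 1 = (b x - 1) * (b y - 1) + ((b x - 1) + (b y - 1)).
    rewrite (group_basisM bG) mulrBr mulr1 addrA subrK.
    by rewrite mulrBl mul1r addrA subrK.
  rewrite memvD //; last by rewrite memvD.
  apply: (subvP (sDc _)).
  by rewrite expvSr memv_mul ?(aug_ideal_basis bG) ?(aug_power_of_lcn bG).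
have -> : b [~ x, y]%g - 1 = ((b x - 1) * (b y - 1) - (b y - 1) * (b x - 1)) -
    (b (y * x)%g - 1) * (b [~ x, y]%g - 1).
  by rewrite (basis_comm_sub1E bG) addrK.
rewrite memvB //.
  apply: (lcn_layer_comm cH); first exact: IHk.
  by rewrite -eqD (aug_ideal_basis bG).
apply: (subvP (sDc _)); rewrite expvSl memv_mul ?(aug_ideal_basis bG) //.
by apply: (aug_power_of_lcn bG); rewrite lcnSn mem_commg ?inE.
Qed.

End LieLayers.

Section LcnExponent.
Variables (F : fieldType) (A : falgType F) (p : nat).
Hypothesis charF : p \in [pchar F].
Variables (G H : finGroupType) (b : G -> A) (c : H -> A).
Hypotheses (bG : group_basis b) (cH : group_basis c).
Hypotheses (pG : p.-group [set: G]) (pH : p.-group [set: H]).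

Lemma lcn_eq1_exp_p k : (forall x : H, x ^+ p = 1)%g ->
  'L_k.+1([set: G])%g = 1%g -> 'L_k.+1([set: H])%g = 1%g.
Proof.
move=> H1 LG; have eqD := aug_eq charF bG cH pH.
have nilH := pgroup_nil pH; apply/eqP/negPn/negP => ntL.
have prL : 'L_k.+2([set: H])%g \proper 'L_k.+1([set: H])%g.
  rewrite lcnSn; apply: (nil_comm_properl nilH) => //; first exact: lcn_sub.
  by rewrite subsetI subxx; apply: lcn_norm.
have := proper_subn prL; case/negP.
apply/subsetP=> x Lx; apply: (lcn_of_aug_power charF cH pH H1).
have := subvP (lcn_layer_sub charF cH bG pG k) _ (lcn_layer_mem c Lx).
rewrite /lcn_layer LG -eqD; apply: subvP; rewrite subv_add subvv andbT.
apply/span_subvP=> _ /imageP[y /set1P-> ->].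
by rewrite (group_basis1 bG) subrr mem0v.
Qed.

End LcnExponent.

(** * Isomorphic group algebras *)

Section FinGalg.
Variables (F : fieldType) (G : finGroupType).
Local Notation FG := (group_algebra F G).

Lemma galg_vect_axiom : Vector.axiom #|G| FG.
Proof.
exists (fun u : {malg F[G]} => \row_i u@_(enum_val i)).
  by move=> a u v; apply/rowP=> i; rewrite !mxE mcoeffD mcoeffZ.
exists (fun r : 'rV_#|G| => \sum_i << r 0 i *g enum_val i >> : {malg F[G]}).
  move=> u; apply/malgP=> x; rewrite raddf_sum (bigD1 (enum_rank x)) //= mxE.
  rewrite enum_rankK mcoeffUU big1 ?addr0 // => i nix.
  rewrite mcoeffU; case: eqP => // exi; by rewrite -exi enum_valK eqxx in nix.
move=> r; apply/rowP=> i; rewrite mxE raddf_sum (bigD1 i) //= mcoeffUU.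
rewrite big1 ?addr0 // => j nij; rewrite mcoeffU.
by case: eqP => // /enum_val_inj eji; rewrite eji eqxx in nij.
Qed.

HB.instance Definition _ := Lmodule_hasFinDim.Build F FG galg_vect_axiom.
HB.instance Definition _ := Algebra_isFalgebra.Build F FG.

Definition galg_basis (x : G) : FG := << x >>.

Lemma galg_sum (u : FG) : u = \sum_x (u : {malg F[G]})@_x *: galg_basis x.
Proof.
apply/malgP=> x; rewrite raddf_sum (bigD1 x) //= mcoeffZ mcoeffUU mulr1.
rewrite big1 ?addr0 // => y nyx; rewrite mcoeffZ mcoeffU.
by rewrite (negPf nyx) mulr0.
Qed.

Lemma galg_basisP : group_basis galg_basis.
Proof.
split=> [|x y|]; first by [].
  by rewrite /galg_basis -[RHS]/(galg_mul _ _) galg_mulUU mulr1.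
rewrite basisEdim; apply/andP; split.
  apply/subvP=> u _; rewrite (galg_sum u) memv_suml // => x _.
  by rewrite memvZ // memv_span // codom_f.
by rewrite size_codom dimvf.
Qed.

End FinGalg.

Lemma group_basis_iso (F : fieldType) (A B : falgType F) (G : finGroupType)
    (b : G -> A) (f : {lrmorphism A -> B}) :
  bijective f -> group_basis b -> group_basis (f \o b).
Proof.
case=> g fK gK [b1 bM bB]; split=> [|x y|] /=.
- by rewrite b1 rmorph1.
- by rewrite bM rmorphM.
have kf : (lker (linfun f) = 0)%VS.
  by apply/eqP/lker0P=> u v; rewrite !lfunE => /(can_inj fK).
have -> : codom (f \o b) = map (linfun f) (codom b).
  rewrite /codom /image_mem -[RHS]map_comp.
  by apply: eq_map => x; rewrite /= lfunE.
have -> : fullv = (linfun f @: fullv)%VS :> {vspace B}.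
  by apply/esym/vspaceP=> v; rewrite memvf -[v]gK -[f _]lfunE memv_img ?memvf.
by apply: limg_basis_of bB; rewrite kf capv0.
Qed.

Lemma fin_group_of_seq (H : groupType) (s : seq H) :
  (forall x, x \in s) -> exists K : finGroupType, (K : groupType) = H.
Proof.
move=> sP.
pose e : seq H := undup s.
have eP : Finite.axiom e.
  by move=> x; rewrite count_uniq_mem ?undup_uniq // mem_undup sP.
pose f x := index x e.
have fK : pcancel f (fun n => nth None (map some e) n).
  by move=> x; rewrite (nth_map x) ?nth_index ?index_mem ?mem_undup.
case: H s sP @e eP @f fK => T c s sP e eP f fK.
pose K : finGroupType := HB.pack T c (PCanIsCountable fK) (isFinite.Build _ eP).
by exists K.
Qed.

(** The supports of the images of the elements of G cover H, as they span FH. *)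
Lemma galg_iso_finite (F : fieldType) (G : finGroupType) (H : groupType) :
  galg_isomorphic F G H -> exists K : finGroupType, (K : groupType) = H.
Proof.
case=> f [g fK gK].
pose supp x : seq H := msupp (f (galg_basis F x) : {malg F[H]}).
apply: (@fin_group_of_seq H (flatten [seq supp x | x : G])) => h.
have : (<< h >> : {malg F[H]})@_h != 0 by rewrite mcoeffUU oner_eq0.
rewrite -[<< h >>]gK (galg_sum (g << h >>)) linear_sum raddf_sum /= => nz.
have [x nzx] : exists x, (f (galg_basis F x) : {malg F[H]})@_h != 0.
  apply/existsP; apply: contraNT nz; rewrite negb_exists => /forallP z.
  rewrite big1 // => x _; rewrite linearZ mcoeffZ.
  by have := z x; rewrite negbK => /eqP->; rewrite mulr0.
by apply/flatten_imageP; exists x; rewrite // /supp -mcoeff_neq0.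
Qed.

Local Open Scope group_scope.

Theorem theorem2 (p : nat) (p_prime : prime p)
    (G : finGroupType) (pG : p.-group [set: G])
    (F : fieldType) (charF : p \in [pchar F]%R)
    (condG : [\/ exponent [set: G] = p,
                 nil_class [set: G] = 2,
                 cyclic ([set: G]^`(1))
               | maximal_class p [set: G] /\
                 exists A : {group G}, abelian A /\ #|[set: G] : A| = p])
    (H : groupType) (isoFGFH : galg_isomorphic F G H) :
  nilpotent_of_class H (nil_class [set: G]).
Proof.
have [K defH] := galg_iso_finite isoFGFH; case: _ / defH in isoFGFH *.
case: isoFGFH => f bijf.
have bG := group_basis_iso bijf (galg_basisP F G).
have cK := galg_basisP F K.
have oGK := card_group_eq bG cK.
have pK : p.-group [set: K] by rewrite /pgroup -oGK.
apply/nilpotent_of_classP.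
have nilG := pgroup_nil pG; have nilK := pgroup_nil pK.
split=> //.
have eqD := card_der1_eq bG cK.
have eqC := card_center_der1_eq charF bG cK pG pK.
have caseCyc : cyclic [set: G]^`(1) -> nil_class [set: K] = nil_class [set: G].
  move=> cG; have cyK := cyclic_der1_eq charF bG cK pK cG.
  apply: nil_class_eq => // -[|n].
    by rewrite !lcn1 !trivg_card1 oGK.
  by rewrite !trivg_card1 (card_lcn_der1_cyclic p_prime pG pK cG cyK eqD eqC).
case: condG => [expG | clG | // | [[n [n2 oG clG]] [A [abA iA]]]].
- have G1 (x : G) : x ^+ p = 1 by rewrite -expG expg_exponent ?inE.
  have K1 := exponent_p_eq charF bG cK pK G1.
  apply: nil_class_eq => // n; apply/eqP/eqP.
    exact: (lcn_eq1_exp_p charF bG cK pG pK K1).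
  exact: (lcn_eq1_exp_p charF cK bG pK pG G1).
- rewrite clG; apply/eqP/(nil_class2P nilK).
  have [ntD sDZ] := nil_class2P nilG (introT eqP clG).
  rewrite -cardG_gt1 -eqD cardG_gt1; split=> //.
  rewrite subsetI der_sub; apply/setIidPl/eqP.
  rewrite eqEcard subsetIl -eqC -eqD /= subset_leq_card //.
  by rewrite subsetI subxx (subset_trans sDZ) ?subsetIr.
(* a group of order p ^ 2 has maximal class but is abelian *)
have [abG | nabG] := boolP (abelian [set: G]).
  apply: caseCyc; suff -> : [set: G]^`(1) = 1 by apply: cyclic1.
  exact/commG1P.
have [n3 iD oZ] := maximal_class_indices p_prime oG clG nabG.
have iDK : #|[set: K] : [set: K]^`(1)| = (p ^ 2)%N.
  by rewrite -(index_der1_eq bG cK).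
have oZK : #|'Z([set: K])| = p by rewrite -(card_center_eq charF bG cK pG pK).
have nabK : ~~ abelian [set: K].
  apply: contra nabG => /commG1P DK; apply/commG1P/eqP.
  by rewrite trivg_card1 eqD [_^`(1)]DK cards1.
have le_p := irr1_le_invariant p_prime pG pK oGK (card_classes_eq bG cK)
  (index_der1_eq bG cK).
have [|M [sM abM iM]] := abelian_index_p_of_irr1_le p_prime pK oZK nabK.
  apply: le_p => i; rewrite -iA; apply: irr1_le_abelian_index => //.
  exact: subsetT.
rewrite clG.
apply: (nil_class_of_abelian_index_p p_prime _ n3 sM abM iM oZK iDK).
by rewrite -oGK.
Qed.
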